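(* Let $\mathbb{G}$ be a stratified Lie group of homogeneous dimension $Q$ and let $\Omega\subset\mathbb{G}$ be an open subset. Let $0<s<1\le p<+\infty$ and $Q=ps$. Then $X_0^{s,p}(\Omega)$ is continuously embedded into $L^r(\Omega)$ for every $p\le r<+\infty$; that is, for each such $r$ there exists a constant $C>0$ (depending on $Q,s,p,\Omega$ and $r$) such that, for every $u\in X_0^{s,p}(\Omega)$, $$\|u\|_{L^r(\Omega)}\le C\,\|u\|_{X_0^{s,p}(\Omega)}.$$ Moreover, if $\Omega$ is a bounded domain, then $X_0^{s,p}(\Omega)$ is compactly embedded into $L^r(\Omega)$ for every $1\le r<+\infty$.
   Context: A stratified Lie group is $\mathbb{G}=(\mathbb{R}^N,\circ)$ with $\mathbb{R}^N=\mathbb{R}^{N_1}\times\cdots\times\mathbb{R}^{N_k}$ such that for every $\lambda>0$ the dilation $D_\lambda(x^{(1)},\dots,x^{(k)})=(\lambda x^{(1)},\lambda^2x^{(2)},\dots,\lambda^k x^{(k)})$ is a group automorphism, and such that the left-invariant vector fields $X_1,\dots,X_{N_1}$ with $X_j(0)=\partial/\partial x_j|_0$ generate, via iterated commutators, a Lie algebra of rank $N$ at every point. We write $\lambda x$ for $D_\lambda(x)$ and $y^{-1}x$ for $y^{-1}\circ x$. The homogeneous dimension is $Q=N_1+2N_2+\dots+kN_k$. The Haar measure $dx$ is Lebesgue measure on $\mathbb{R}^N$. A homogeneous quasi-norm $|\cdot|:\mathbb{G}\to[0,\infty)$ is fixed: it is continuous, $|x|=0$ iff $x=0$, $|x^{-1}|=|x|$,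 and $|\lambda x|=\lambda|x|$ for $\lambda>0$. It is taken so that $d(x,y)=|y^{-1}x|$ is a (left-invariant, homogeneous) distance on $\mathbb{G}$. For an open set $U\subset\mathbb{G}$, the Gagliardo semi-norm is $$[u]_{s,p,U}=\left(\int_U\int_U\frac{|u(x)-u(y)|^p}{|y^{-1}x|^{Q+ps}}\,dx\,dy\right)^{1/p},$$ and $W^{s,p}(U)=\{u\in L^p(U):[u]_{s,p,U}<\infty\}$. The space $X_0^{s,p}(\Omega)$ is the completion of $C_0^\infty(\Omega)$ (functions extended by $0$ to $\mathbb{G}$) under the norm $\|u\|_{X_0^{s,p}(\Omega)}=\|u\|_{L^p(\Omega)}+[u]_{s,p,\mathbb{G}}$; its elements are functions $u\in W^{s,p}(\mathbb{G})$ with $u=0$ in $\mathbb{G}\setminus\Omega$. When $\Omega$ is bounded, a Poincaré inequality $\|u\|_{L^p(\Omega)}\le C[u]_{s,p,\mathbb{G}}$ holds on this space and $[u]_{s,p,\mathbb{G}}$ is an equivalent norm. *)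

(* Defs.v *)
From HB Require Import structures.
From mathcomp Require Import all_boot all_order all_algebra.
From mathcomp Require Import all_classical all_reals all_analysis.
From mathcomp Require Import measurable_realfun hoelder lra.
Set Implicit Arguments.
Unset Strict Implicit.
Unset Printing Implicit Defensive.
Import Order.TTheory GRing.Theory Num.Theory.
Import numFieldNormedType.Exports.
Local Open Scope classical_set_scope.
Local Open Scope ring_scope.

(** * Lebesgue measure on R^n, on the Borel sigma-algebra of ['rV[R]_n] *)

HB.instance Definition _ (R : realType) (m n : nat) :=
  @isMeasurable.Build (sigma_display (@open 'M[R]_(m, n)))
    'M[R]_(m, n) <<s @open 'M[R]_(m, n) >>
    (@sigma_algebra0 _ setT _) (@sigma_algebraC _ _)
    (@sigma_algebra_bigcup _ setT _).

Section lebesgue_rV.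
Context {R : realType}.

Definition rV_cons (n : nat) (tx : R * 'rV[R]_n) : 'rV[R]_(1 + n) :=
  row_mx tx.1%:M tx.2.

Definition rV_uncons (n : nat) (x : 'rV[R]_(1 + n)) : R * 'rV[R]_n :=
  (x 0 0, rsubmx x).

Lemma rV_cons0 n (t : R) (x : 'rV[R]_n) : rV_cons (t, x) 0 ord0 = t.
Proof.
have -> : ord0 = lshift n 0 :> 'I_(1 + n) by apply/val_inj.
by rewrite (row_mxEl t%:M x) mxE eqxx.
Qed.

Lemma rV_consS n (t : R) (x : 'rV[R]_n) (j : 'I_n) :
  rV_cons (t, x) 0 (lift ord0 j) = x 0 j.
Proof.
have -> : lift ord0 j = rshift 1 j :> 'I_(1 + n) by apply/val_inj.
by rewrite (row_mxEr t%:M x).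
Qed.

Lemma rV_consK n : cancel (@rV_cons n) (@rV_uncons n).
Proof.
move=> [t x]; rewrite /rV_uncons /rV_cons/= row_mxKr; congr pair.
exact: rV_cons0.
Qed.

Lemma open_measurable_mx m n (U : set 'M[R]_(m, n)) : open U -> measurable U.
Proof. by move=> oU; exact: sub_sigma_algebra. Qed.

Lemma rV_rat_ball n (U : set 'rV[R]_n) (x : 'rV[R]_n) : open U -> U x ->
  exists (c : 'rV[rat]_n) (q : rat), [/\ ball (map_mx ratr c : 'rV[R]_n) (ratr q) x
    & ball (map_mx ratr c : 'rV[R]_n) (ratr q) `<=` U].
Proof.
move=> oU Ux.
have /nbhs_ballP[e /= e0 eU] : nbhs x U by exact: open_nbhs_nbhs.
have [q] : exists q : rat, ratr q \in `](e / 4), (e / 2)[%R.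
  by apply: rat_in_itvoo; lra.
rewrite in_itv/= => /andP[q4 q2].
have H j : exists c : rat, ratr c \in `](x 0 j - e / 4), (x 0 j + e / 4)[%R.
  by apply: rat_in_itvoo; lra.
pose c := \row_j projT1 (cid (H j)).
have q0 : 0 < (ratr q : R) by apply: lt_trans q4; rewrite divr_gt0.
have cx : ball (map_mx ratr c : 'rV[R]_n) (ratr q) x.
  split => // i j; rewrite !mxE !ord1; case: cid => /= cj.
  rewrite in_itv/= => /andP[c1 c2].
  rewrite /ball/= ltr_norml; lra.
exists c, q; split => // y cy; apply: eU.
apply: (@le_ball _ _ _ (ratr q + ratr q)); first by lra.
by apply: ball_triangle cy; exact: ball_sym.
Qed.

Lemma measurable_rV_cons n : measurable_fun setT (@rV_cons n).
Proof.
apply: (@measurability _ _ _ _ _ _ (@open 'rV[R]_(1 + n))) => //.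
move=> _ [U oU <-]; rewrite setTI.
pose B (cq : 'rV[rat]_(1 + n) * rat) : set 'rV[R]_(1 + n) :=
  ball (map_mx ratr cq.1 : 'rV[R]_(1 + n)) (ratr cq.2).
pose F cq := if pselect (B cq `<=` U) then @rV_cons n @^-1` (B cq) else set0.
have -> : @rV_cons n @^-1` U = \bigcup_cq F cq.
  apply/seteqP; split => [tx /= Utx|tx [cq _]]; last first.
    by rewrite /F; case: pselect => // BU /BU.
  have [c [q [cx cU]]] := rV_rat_ball oU Utx.
  by exists (c, q) => //; rewrite /F; case: pselect.
apply: countable_bigcupT_measurable; first exact: countableP.
move=> [c q].
suff mB : measurable (@rV_cons n @^-1` B (c, q)).
  by rewrite /F; destruct (pselect _); [exact: mB|exact: measurable0].
rewrite /B/=.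
move: (map_mx ratr c : 'rV[R]_(1 + n)) => C.
have [q0|q0] := ltP 0 (ratr q : R); last first.
  suff -> : @rV_cons n @^-1` ball C (ratr q) = set0 by [].
  by apply/seteqP; split => // tx [+ _]; rewrite ltNge q0.
suff -> : @rV_cons n @^-1` ball C (ratr q) =
    ball (rV_uncons C).1 (ratr q) `*` ball (rV_uncons C).2 (ratr q).
  apply: measurableX; first exact: measurable_ball.
  apply: open_measurable_mx.
  exact: ball_open.
apply/seteqP; split => [[t x] [_ h]|[t x] [/= ht [_ hx]]].
  split => /=.
    have := h 0 (lshift n 0); rewrite /rV_cons/= row_mxEl mxE eqxx mulr1n.
    by congr (ball (C _ _) _ _); apply/val_inj.
  split => // i j; have := h i (rshift 1 j).
  by rewrite /rV_cons/= row_mxEr mxE.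
split => // i j; rewrite /rV_cons/= (ord1 i).
case: (split_ordP j) => j' ->.
  rewrite row_mxEl (ord1 j') mxE eqxx mulr1n; move: ht.
  by congr (ball (C _ _) _ _); apply/val_inj.
by rewrite row_mxEr; have := hx 0 j'; rewrite mxE.
Qed.

Lemma continuous_rV_coord n (j : 'I_n) : continuous (fun x : 'rV[R]_n => x 0 j).
Proof. exact: coord_continuous. Qed.

Lemma measurable_rV_coord n (j : 'I_n) :
  measurable_fun setT (fun x : 'rV[R]_n => x 0 j).
Proof.
apply: (@measurability _ _ _ _ _ _ (@RGenOpens.G R)).
  exact: RGenOpens.measurableE.
move=> _ [_ [a [b ->] <-]]; rewrite setTI; apply: open_measurable_mx.
move/continuousP: (@continuous_rV_coord n j); apply.
exact: interval_open.
Qed.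

Lemma measurable_rV_uncons n : measurable_fun setT (@rV_uncons n).
Proof.
apply: (@measurable_fun_pair _ _ _ _ _ _ (fun x : 'rV[R]_(1 + n) => x 0 0) rsubmx).
  exact: measurable_rV_coord.
apply: (@measurability _ _ _ _ _ _ (@open 'rV[R]_n)) => //.
move=> _ [U oU <-]; rewrite setTI; apply: open_measurable_mx.
suff /continuousP : continuous (rsubmx : 'rV[R]_(1 + n) -> 'rV[R]_n) by exact.
move=> x A /nbhs_ballP[e /= e0 eA].
apply/nbhs_ballP; exists e => //= y [_ xy]; apply: eA.
by split => // i j; rewrite !mxE.
Qed.

Section cons_measure.
Context (n : nat) (mu : {sigma_finite_measure set 'rV[R]_n -> \bar R}).

Definition rV_cons_measure : set 'rV[R]_(1 + n) -> \bar R :=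
  pushforward (@lebesgue_measure R \x mu)%E (@rV_cons n).

HB.instance Definition _ := Measure.copy rV_cons_measure
  (measure_function.measure_function_pushforward__canonical__measure_function_Measure
    ((@lebesgue_measure R \x mu)%E : {measure set _ -> \bar R})
    (@measurable_rV_cons n)).

Let rV_cons_measure_sigma_finite : sigma_finite setT rV_cons_measure.
Proof.
have /sigma_finiteP[F [TF ndF Foo]] := sigma_finiteT (@lebesgue_measure R).
have /sigma_finiteP[G [TG ndG Goo]] := sigma_finiteT mu.
exists (fun i => @rV_uncons n @^-1` (F i `*` G i)).
  rewrite -preimage_bigcup -[LHS](@preimage_setT _ _ (@rV_uncons n)).
  congr (_ @^-1` _); rewrite -setXTT TF TG predeqE => -[t x]; split.
    move=> [/= [i _ Fit] [j _ Gjx]]; exists (maxn i j) => //; split.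
    - by move: t Fit; exact/subsetPset/ndF/leq_maxl.
    - by move: x Gjx; exact/subsetPset/ndG/leq_maxr.
  by move=> [i _ []/= ? ?]; split; exists i.
move=> i; have [mF Fi] := Foo i; have [mG Gi] := Goo i; split.
  by rewrite -[X in measurable X]setTI; apply: measurable_rV_uncons => //;
    exact: measurableX.
rewrite /rV_cons_measure /pushforward -comp_preimage.
have -> : @rV_uncons n \o @rV_cons n = id.
  by apply/funext => tx; exact: rV_consK.
by rewrite preimage_id product_measure1E// lte_mul_pinfty// ge0_fin_numE.
Qed.

HB.instance Definition _ := Measure_isSigmaFinite.Build _ _ _ rV_cons_measure
  rV_cons_measure_sigma_finite.

End cons_measure.

Fixpoint lebesgue_rV (n : nat) : {sigma_finite_measure set 'rV[R]_n -> \bar R} :=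
  if n is n'.+1 then rV_cons_measure (lebesgue_rV n') else \d_(0 : 'rV[R]_0).

Lemma measurable_rV_box n (A : 'I_n -> set R) : (forall j, measurable (A j)) ->
  measurable [set x : 'rV[R]_n | forall j, A j (x 0 j)].
Proof.
move=> mA.
suff -> : [set x : 'rV[R]_n | forall j, A j (x 0 j)] =
    \bigcap_(j in [set: 'I_n]) ((fun x : 'rV[R]_n => x 0 j) @^-1` A j).
  apply: fin_bigcap_measurable => // j _.
  rewrite -[X in measurable X]setTI.
  exact: measurable_rV_coord.
by apply/seteqP; split => x /= h j; [move=> _; exact: h|exact: h].
Qed.

Lemma lebesgue_rV_box n (A : 'I_n -> set R) : (forall j, measurable (A j)) ->
  lebesgue_rV n [set x | forall j, A j (x 0 j)] =
  (\prod_(j < n) @lebesgue_measure R (A j))%E.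
Proof.
elim: n A => [|n IH] A mA.
  rewrite big_ord0 /= diracE mem_set//; by case.
rewrite big_ord_recl -(IH (fun j => A (lift ord0 j)))// /= /rV_cons_measure.
rewrite /pushforward -product_measure1E; first last.
  exact: (@measurable_rV_box n (fun j => A (lift ord0 j))).
  exact: mA.
congr ((_ \x _)%E _); apply/seteqP; split => [[t x]/= h|[t x]/= [h1 h2] j].
  split; first by have := h ord0; rewrite rV_cons0.
  by move=> j; have := h (lift ord0 j); rewrite rV_consS.
by have [i ->|->] := unliftP ord0 j; rewrite ?rV_cons0 ?rV_consS.
Qed.

End lebesgue_rV.

(** * Smooth maps *)

Section smooth.
Context {R : realType} {V W : normedModType R}.

Fixpoint iter_derive (vs : seq V) (f : V -> W) : V -> W :=
  if vs is v :: vs' then 'D_v (iter_derive vs' f) else f.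

(* C^oo for V finite-dimensional: all iterated directional derivatives, of all
   orders, exist and are continuous. *)
Definition smooth (f : V -> W) : Prop :=
  forall vs : seq V, continuous (iter_derive vs f) /\
    forall v x, derivable (iter_derive vs f) x v.

Definition test_function (Omega : set V) (f : V -> W) : Prop :=
  [/\ smooth f, compact (closure [set x | f x != 0])
    & closure [set x | f x != 0] `<=` Omega].

End smooth.

(** * Stratified Lie groups *)

(* R^N = R^(n 0) x ... x R^(n k.-1) is ['rV[R]_(\sum_i n i)], whose i-th block
   is [submxrow x i]; layers are counted from 0, so layer i has weight i.+1. *)
Definition dilation {R : realType} k (n : 'I_k -> nat) (l : R)
    (x : 'rV[R]_(\sum_i n i)) : 'rV[R]_(\sum_i n i) :=
  \mxrow_(i < k) (l ^+ i.+1 *: submxrow x i).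

Definition homogeneous_dim k (n : 'I_k -> nat) : nat :=
  (\sum_(i < k) i.+1 * n i)%N.

(* Vector fields on R^N are identified with their coefficient functions, so that
   [X, Y] = DY.X - DX.Y. *)
Definition lie_bracket {R : realType} N (X Y : 'rV[R]_N -> 'rV[R]_N)
    (x : 'rV[R]_N) : 'rV[R]_N :=
  'D_(X x) Y x - 'D_(Y x) X x.

Inductive lie_generated {R : realType} N (S : set ('rV[R]_N -> 'rV[R]_N)) :
    ('rV[R]_N -> 'rV[R]_N) -> Prop :=
| LieGen X : S X -> lie_generated S X
| LieAdd X Y : lie_generated S X -> lie_generated S Y ->
    lie_generated S (fun x => X x + Y x)
| LieScale (a : R) X : lie_generated S X -> lie_generated S (fun x => a *: X x)
| LieBracket X Y : lie_generated S X -> lie_generated S Y ->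
    lie_generated S (lie_bracket X Y).

(* The left-invariant field equal to v at the identity 0: its value at x is the
   image of v under the differential at 0 of the left translation by x. *)
Definition left_invariant_field {R : realType} N
    (op : 'rV[R]_N -> 'rV[R]_N -> 'rV[R]_N) (v : 'rV[R]_N) :
    'rV[R]_N -> 'rV[R]_N :=
  fun x => 'D_v (op x) 0.

(* X_1, ..., X_(N_1): [tagnat.sig1 j] is the layer of the coordinate j. *)
Definition first_layer_fields {R : realType} k (n : 'I_k -> nat)
    (op : 'rV[R]_(\sum_i n i) -> 'rV[R]_(\sum_i n i) -> 'rV[R]_(\sum_i n i)) :
    set ('rV[R]_(\sum_i n i) -> 'rV[R]_(\sum_i n i)) :=
  [set left_invariant_field op (delta_mx 0 j) |
    j in [set j : 'I_(\sum_i n i) | tagnat.sig1 j == 0%N :> nat]].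

(* The identity element is 0, as it must be fixed by all the dilations. *)
Record stratified_group (R : realType) k (n : 'I_k -> nat) := StratifiedGroup {
  sg_op : 'rV[R]_(\sum_i n i) -> 'rV[R]_(\sum_i n i) -> 'rV[R]_(\sum_i n i) ;
  sg_inv : 'rV[R]_(\sum_i n i) -> 'rV[R]_(\sum_i n i) ;
  sg_opA : associative sg_op ;
  sg_op0x : left_id 0 sg_op ;
  sg_opx0 : right_id 0 sg_op ;
  sg_opVx : left_inverse 0 sg_inv sg_op ;
  sg_opxV : right_inverse 0 sg_inv sg_op ;
  sg_op_smooth : smooth (fun xy : 'rV[R]_(\sum_i n i) * 'rV[R]_(\sum_i n i) =>
    sg_op xy.1 xy.2) ;
  sg_inv_smooth : smooth sg_inv ;
  sg_dilation : forall (l : R), 0 < l ->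
    {morph dilation l : x y / sg_op x y} ;
  sg_rank : forall x, exists2 Y : 'I_(\sum_i n i) ->
      ('rV[R]_(\sum_i n i) -> 'rV[R]_(\sum_i n i)),
    forall i, lie_generated (first_layer_fields sg_op) (Y i) &
    \rank (\matrix_i Y i x) = (\sum_i n i)%N }.

(* The last clause is the triangle inequality for d(x, y) = |y^-1 x|. *)
Record homogeneous_norm (R : realType) k (n : 'I_k -> nat)
    (G : stratified_group R n) (N : 'rV[R]_(\sum_i n i) -> R) : Prop := {
  hn_continuous : continuous N ;
  hn_ge0 : forall x, 0 <= N x ;
  hn_eq0 : forall x, N x = 0 <-> x = 0 ;
  hn_inv : forall x, N (sg_inv G x) = N x ;
  hn_dilation : forall (l : R) x, 0 < l -> N (dilation l x) = l * N x ;
  hn_triangle : forall x y z, N (sg_op G (sg_inv G y) x) <=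
    N (sg_op G (sg_inv G z) x) + N (sg_op G (sg_inv G y) z) }.

(** * Function spaces *)

(* Elements of the spaces below are representatives: Borel functions, each
   standing for its class modulo almost everywhere equality. *)

Section Lp.
Context {R : realType} {N : nat}.
Implicit Types (U : set 'rV[R]_N) (u : 'rV[R]_N -> R).

Definition Lp_norm (r : R) U u : \bar R :=
  'N[@lebesgue_rV R N]_(r%:E)[EFin \o (u \_ U)].

Definition Lp_space (r : R) U : set ('rV[R]_N -> R) :=
  [set u | measurable_fun U u /\ (Lp_norm r U u < +oo)%E].

End Lp.

Section fractional_sobolev.
Context {R : realType} {k : nat} {n : 'I_k -> nat}.
Variables (G : stratified_group R n) (N : 'rV[R]_(\sum_i n i) -> R) (s p : R).
Implicit Types (U Omega : set 'rV[R]_(\sum_i n i))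
  (u : 'rV[R]_(\sum_i n i) -> R).

(* The quotient is 0 on the diagonal, which is negligible. *)
Definition gagliardo U u : \bar R :=
  ((\int[@lebesgue_rV R _]_(y in U) \int[@lebesgue_rV R _]_(x in U)
    (`|u x - u y| `^ p /
      N (sg_op G (sg_inv G y) x) `^ ((homogeneous_dim n)%:R + p * s))%:E)
    `^ p^-1)%E.

Definition W_space U : set ('rV[R]_(\sum_i n i) -> R) :=
  [set u | Lp_space p U u /\ (gagliardo U u < +oo)%E].

Definition X0_norm Omega u : \bar R := (Lp_norm p Omega u + gagliardo setT u)%E.

(* The completion of C_0^oo(Omega), realized as the closure of C_0^oo(Omega) in
   the functions of W^(s,p)(G) vanishing outside Omega. *)
Definition X0_space Omega : set ('rV[R]_(\sum_i n i) -> R) :=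
  [set u | [/\ W_space setT u,
      {ae @lebesgue_rV R _, forall x, ~ Omega x -> u x = 0} &
      exists2 phi : nat -> 'rV[R]_(\sum_i n i) -> R,
        forall i, test_function Omega (phi i : _ -> R^o) &
        X0_norm Omega (u \- phi i) @[i --> \oo] --> 0%E]].

End fractional_sobolev.

(** * Embeddings between spaces of functions *)

Section embedding.
Context {R : realType} {T : Type}.
Variables (X : set (T -> R)) (normX : (T -> R) -> \bar R).
Variables (Y : set (T -> R)) (normY : (T -> R) -> \bar R).

Definition continuously_embedded : Prop :=
  X `<=` Y /\
  exists2 C : R, 0 < C & forall u, X u -> (normY u <= C%:E * normX u)%E.

(* Bounded sequences of X have subsequences converging in Y. *)
Definition compactly_embedded : Prop :=
  continuously_embedded /\
  forall (u : nat -> T -> R) (M : R),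
    (forall i, X (u i)) -> (forall i, (normX (u i) <= M%:E)%E) ->
    exists (e : nat -> nat) (v : T -> R),
      [/\ {homo e : i j / (i < j)%N}, Y v &
        normY (u (e i) \- v) @[i --> \oo] --> 0%E].

End embedding.

(* Main.v *)
Require Import Defs.
From HB Require Import structures.
From mathcomp Require Import all_boot all_order all_algebra.
From mathcomp Require Import all_classical all_reals all_analysis.
From mathcomp Require Import measurable_realfun hoelder ring lra.
Set Implicit Arguments.
Unset Strict Implicit.
Unset Printing Implicit Defensive.
Import Order.TTheory GRing.Theory Num.Theory.
Import numFieldNormedType.Exports.
Local Open Scope classical_set_scope.
Local Open Scope ring_scope.

(* With Q = p s the seminorm reads [u]^p = int int |u x - u y|^p / d(x, y)^(2Q).
   By homogeneity and smoothness, left translations are triangular with unit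
   diagonal, so the translate of the anisotropic box of size rho has measure
   omega rho^Q exactly.  A box of twice the measure of E = {|u| > t} sticks out of E,
   whence the inner integral at a point of {|u| > 2t} is at least
   c t^p / |E|, and
      c t^p |{|u| > 2t}| <= [u]^p |{|u| > t}|.
   Along the levels t = lambda 2^k with lambda >= ||u||_p, [u], the measures
   of the superlevel sets thus decay faster than any geometric sequence, which
   bounds every L^r norm, r >= p, by a multiple of lambda.

   For the compactness, |u y - average of u over a box containing y| is at most
   delta + C delta^(1-p) eps^Q (inner integral at y) on boxes of size eps; the
   averages over the finitely many boxes covering Omega converge along an
   ultrafilter on nat, which yields L^1-Cauchy subsequences, and interpolating
   |w|^r between |w| and |w|^(r+p) upgrades them to L^r. *)

(** * Dilations *)

Section dilations.
Context {R : realType} {k : nat} {n : 'I_k -> nat}.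
Implicit Types (j m : 'I_(\sum_i n i)) (l : R) (x y : 'rV[R]_(\sum_i n i)).

(** Layers are counted from 0, so the successor is the power of [l] by which a dilation scales the
    coordinate [j]. *)
Definition weight j : nat := (tagnat.sig1 j).+1.

Lemma le_weight j m : (j <= m)%N -> (weight j <= weight m)%N.
Proof. by move=> jm; rewrite ltnS; exact: (tagnat.le_sig1 jm). Qed.

Lemma dilationE l x j : dilation l x 0 j = l ^+ weight j * x 0 j.
Proof. by rewrite !mxE tagnat.sig2K. Qed.

Lemma dilation1 x : dilation 1 x = x.
Proof. by apply/rowP => j; rewrite dilationE expr1n mul1r. Qed.

Lemma dilationM l l' x : dilation l (dilation l' x) = dilation (l * l') x.
Proof. by apply/rowP => j; rewrite !dilationE exprMn mulrA. Qed.

Lemma dilation_add l x y : dilation l (x + y) = dilation l x + dilation l y.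
Proof.
by apply/rowP => j; rewrite dilationE [X in _ * X]mxE mulrDr [RHS]mxE !dilationE.
Qed.

Lemma dilation_delta l (a : R) m :
  dilation l (a *: delta_mx 0 m) = (l ^+ weight m * a) *: delta_mx 0 m.
Proof.
apply/rowP => j; rewrite dilationE !mxE eqxx/=.
by have [->|] := eqVneq j m; rewrite ?mulr1 // !mulr0.
Qed.

(** Regrouping the coordinates by layer identifies the exponent of [rho] in the measure of a box
    with the homogeneous dimension. *)
Lemma sum_weight : (\sum_j weight j)%N = homogeneous_dim n.
Proof.
rewrite /homogeneous_dim (reindex _ tagnat.rank_bij_on)/=.
under eq_bigr do rewrite /weight /tagnat.sig1 tagnat.rankK.
rewrite (eq_bigr (fun i : 'I_k => \sum_(j < n i) i.+1)%N); last first.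
  by move=> i _; rewrite sum_nat_const card_ord mulnC.
rewrite (@sig_big_dep _ _ _ _ (fun i => 'I_(n i)) xpredT (fun=> xpredT)
  (fun i _ => i.+1)).
by apply: eq_bigl => -[].
Qed.

(** All weights are at least 1, so for [l < 1] every coordinate of [dilation l x] is at most
    [l * C], with one [C] for all coordinates. *)
Lemma cvg_dilation0 x : dilation l x @[l --> 0^'+] --> (0 : 'rV[R]_(\sum_i n i)).
Proof.
pose C := 1 + \sum_j `|x 0 j|.
have xC j : `|x 0 j| <= C.
  by rewrite /C (bigD1 j)//= addrCA lerDl addr_ge0// sumr_ge0.
have C0 : 0 < C by rewrite ltr_pwDl// sumr_ge0.
apply/cvg_ballP => e e0; near=> l; split=> // i j.
have l0 : 0 < l by near: l; exact: nbhs_right_gt.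
have l1 : l < 1 by near: l; exact: nbhs_right_lt.
rewrite (ord1 i) mxE dilationE /ball/= sub0r normrN normrM normrX gtr0_norm//.
apply: (@le_lt_trans _ _ (l * C)).
  apply: ler_pM; rewrite ?exprn_ge0 ?(ltW l0)// /weight.
  by rewrite exprS ger_pMr// exprn_ile1// ltW.
rewrite -ltr_pdivlMr//; near: l; apply: nbhs_right_lt; exact: divr_gt0.
Unshelve. all: by end_near. Qed.

End dilations.

(** The two difference quotients coincide. Directional derivatives thus become derivatives on the
    real line, where the chain rule and the constancy criterion are used. *)
Lemma is_derive_line {R : realType} {V : normedModType R} (f : V -> R)
    (z v : V) (t : R) : derivable (f : V -> R^o) (t *: v + z) v ->
  is_derive t (1 : R) (fun t => f (t *: v + z) : R^o)
    ('D_v (f : V -> R^o) (t *: v + z)).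
Proof.
have E : (fun h : R => h^-1 *: (((fun t => f (t *: v + z)) \o shift t) (h *: 1)
      - f (t *: v + z))) =
    (fun h => h^-1 *: ((f \o shift (t *: v + z)) (h *: v) - f (t *: v + z))).
  by apply/funext => h /=; rewrite [h%:A]mulr1 scalerDl addrA.
by move=> df; split; rewrite /derivable /derive E.
Qed.

Lemma derive_coord {R : realType} {V : normedModType R} a b
    (f : V -> 'M[R]_(a, b)) z v i j : derivable f z v ->
  derivable (fun x => f x i j : R^o) z v /\
  'D_v (fun x => f x i j : R^o) z = 'D_v f z i j.
Proof.
move=> df; split; last by rewrite derive_mx// mxE.
by move/derivable_mxP : df; exact.
Qed.

(** * Left translations in coordinates *)

Section translations.
Context {R : realType} {k : nat} {n : 'I_k -> nat}.
Variable G : stratified_group R n.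
Local Notation V := 'rV[R]_(\sum_i n i).
Implicit Types (i j m : 'I_(\sum_i n i)) (x y : V).

Lemma continuous_sg_op : continuous (fun xy : V * V => sg_op G xy.1 xy.2).
Proof. by have [+ _] := sg_op_smooth G [::]. Qed.

Lemma continuous_sg_inv : continuous (sg_inv G).
Proof. by have [+ _] := sg_inv_smooth G [::]. Qed.

(* By homogeneity, the partial derivative g of the coordinate j in the direction
   m satisfies g z = l ^ (weight m - weight j) * g (dilation l z); let l go to 0. *)
Lemma sg_op_addr x y j m (a : R) : (weight j <= weight m)%N ->
  sg_op G x (y + a *: delta_mx 0 m) 0 j = sg_op G x y 0 j + a * (j == m)%:R.
Proof.
move=> wjm.
pose F (z : V * V) := sg_op G z.1 z.2 0 j.
pose v : V * V := (0, delta_mx 0 m).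
pose D l (z : V * V) : V * V := (dilation l z.1, dilation l z.2).
pose g (z : V * V) : R := 'D_v (F : _ -> R^o) z.
have dF z : derivable (F : _ -> R^o) z v.
  by apply: (derive_coord 0 j _).1; have [_] := sg_op_smooth G [::]; exact.
have gE z : g z = 'D_v (fun xy : V * V => sg_op G xy.1 xy.2) z 0 j.
  apply: (derive_coord 0 j _).2; have [_] := sg_op_smooth G [::]; exact.
have cg : continuous g.
  have -> : g = fun z => 'D_v (fun xy : V * V => sg_op G xy.1 xy.2) z 0 j.
    exact/funext.
  have [cDF _] := sg_op_smooth G [:: v].
  move=> z; apply: (cvg_comp _ (fun M : V => M 0 j) (cDF z)).
  exact: coord_continuous.
have FD l z : 0 < l -> F (D l z) = l ^+ weight j * F z.
  by move=> l0; rewrite /F/= -sg_dilation// dilationE.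
have lineD l z (t : R) : D l (t *: v + z) = (l ^+ weight m * t) *: v + D l z.
  congr pair; rewrite /= dilation_add; congr (_ + _).
    by apply/rowP => i; rewrite dilationE !mxE !mulr0.
  by rewrite dilation_delta.
(* The function [l ^+ weight j * F (t *: v + z)] of [t] is differentiated at 0 in two ways:
   directly, and after moving the dilation inside [F], where [t] gets multiplied by
   [l ^+ weight m]. *)
have gD l z : 0 < l -> l ^+ weight j * g z = l ^+ weight m * g (D l z).
  move=> l0.
  have d1 := is_derive_line (dF (0 *: v + z)).
  have d2 := is_derive_line (dF ((l ^+ weight m * 0) *: v + D l z)).
  rewrite -/(g _) mulr0 !scale0r !add0r in d1 d2.
  have d3 : is_derive (0 : R) (1 : R) (fun t => l ^+ weight m * t) (l ^+ weight m).
    by apply: is_derive_eq; rewrite [LHS]mulr1.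
  have d4 : is_derive (0 : R) (1 : R) (fun t => l ^+ weight j * F (t *: v + z))
      (l ^+ weight m * g (D l z)).
    have -> : (fun t => l ^+ weight j * F (t *: v + z)) =
        (fun t => F (t *: v + D l z)) \o (fun t => l ^+ weight m * t).
      by apply/funext => t /=; rewrite -FD// lineD.
    rewrite mulrC; apply: is_derive1_comp => //; first by rewrite mulr0.
  have d5 : is_derive (0 : R) (1 : R) (fun t => l ^+ weight j * F (t *: v + z))
      (l ^+ weight j * g z).
    exact: (is_deriveZ (l ^+ weight j) d1).
  by rewrite -(@derive_val _ _ _ _ _ _ _ d4) -(@derive_val _ _ _ _ _ _ _ d5).
have dM (t : R) : is_derive t (1 : R) (fun t => t * (j == m)%:R) (j == m)%:R.
  by apply: is_derive_eq; rewrite scaler0 add0r [LHS]mulr1.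
(* At the origin [F] is known along the whole line, because 0 is the identity of the group. *)
have g0 : g 0 = (j == m)%:R.
  have d1 := is_derive_line (dF (0 *: v + 0)).
  rewrite -/(g _) scale0r add0r in d1.
  have E : (fun t => F (t *: v + 0)) = (fun t : R => t * (j == m)%:R).
    by apply/funext => t; rewrite /F/= !addr0 scaler0 sg_op0x !mxE eqxx.
  rewrite E in d1; rewrite -(@derive_val _ _ _ _ _ _ _ d1).
  exact: derive_val.
have gE0 z : g z = (j == m)%:R.
  rewrite -g0 -[z in LHS]addr0.
  (* The natural subtraction is exact since [weight j <= weight m]; the limit uses the continuity of
     [g] at 0. *)
  have cv : l ^+ (weight m - weight j) * g (D l z) @[l --> 0^'+] -->
      (0 : R) ^+ (weight m - weight j) * g 0.
    apply: cvgM.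
      apply: cvg_at_right_filter; exact: exprn_continuous.
    apply: (cvg_comp _ g _ (cg _)).
    exact: (cvg_pair (cvg_dilation0 z.1) (cvg_dilation0 z.2)).
  have ct : l ^+ (weight m - weight j) * g (D l z) @[l --> 0^'+] --> g z.
    apply: cvg_near_cst; near=> l.
    have l0 : 0 < l by near: l; exact: nbhs_right_gt.
    have lj0 : l ^+ weight j != 0 by rewrite expf_neq0// gt_eqF.
    by apply: (mulfI lj0); rewrite gD// mulrA -exprD subnKC.
  rewrite addr0 (cvg_unique _ ct cv)// g0.
  (* For [j = m] the exponent is 0 and [0 ^+ 0 = 1]; otherwise [g 0] vanishes already. *)
  have [->|jm] := eqVneq j m; first by rewrite subnn expr0 mul1r.
  by rewrite mulr0.
(* The derivative along the line is the constant [(j == m)%:R], so [F] is affine in [t]. *)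
pose h (t : R) := F (t *: v + (x, y)) - t * (j == m)%:R.
have : h a = h 0.
  apply: is_derive_0_is_cst => t.
  have d1 := is_derive_line (dF (t *: v + (x, y))).
  by have := is_deriveB d1 (dM t); rewrite -/(g _) gE0 subrr.
rewrite /h /F/= !scale0r !add0r !mul0r subr0 !scaler0 add0r => /eqP.
by rewrite subr_eq => /eqP; rewrite (addrC y).
Unshelve. all: by end_near. Qed.

End translations.

Arguments continuous_sg_op {R k n} G.
Arguments continuous_sg_inv {R k n} G.

(** * Triangular maps preserve the measure of boxes *)

Section triangular_maps.
Context {R : realType}.

(** Nonlinear analogue of a triangular matrix with unit diagonal: the [j]-th coordinate of [T x] is
    [x 0 j] plus a function of the earlier coordinates. *)
Definition triangular N (T : 'rV[R]_N -> 'rV[R]_N) : Prop :=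
  forall (j : 'I_N) (x y : 'rV[R]_N), (forall m : 'I_N, (m < j)%N -> x 0 m = y 0 m) ->
  T x 0 j - x 0 j = T y 0 j - y 0 j.

Lemma rV_uncons2E N (x : 'rV[R]_(1 + N)) j : (rV_uncons x).2 0 j = x 0 (lift ord0 j).
Proof.
rewrite mxE; congr (x _ _); exact/val_inj.
Qed.

(** By induction on the dimension and Tonelli: the first coordinate is only shifted by a constant,
    and once it is fixed the other coordinates undergo a triangular map in dimension [N], whose box
    has a measure independent of the slice. *)
Lemma lebesgue_rV_triangular N (T : 'rV[R]_N -> 'rV[R]_N) (a : 'I_N -> R) :
  measurable_fun setT T -> triangular T -> (forall j, 0 < a j) ->
  lebesgue_rV N [set x | forall j, `|T x 0 j| < a j] = (\prod_j (2 * a j))%:E.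
Proof.
elim: N T a => [|N IH] T a mT tT a0.
  by rewrite big_ord0/= diracE mem_set//= => -[].
pose Tt (t : R) (y : 'rV[R]_N) := (rV_uncons (T (rV_cons (t, y)))).2.
have TtE t y j : Tt t y 0 j = T (rV_cons (t, y)) 0 (lift ord0 j).
  exact: rV_uncons2E.
have mTt t : measurable_fun setT (Tt t).
  exact: (measurableT_comp measurable_snd
    (measurableT_comp (@measurable_rV_uncons R N)
      (measurableT_comp mT
        (measurableT_comp (@measurable_rV_cons R N) (pair1_measurable t))))).
have tTt t : triangular (Tt t).
  move=> j x y xy; rewrite !TtE -(rV_consS t x) -(rV_consS t y); apply: tT => m.
  have [i ->|->] := unliftP ord0 m; last by rewrite !rV_cons0.
  by rewrite !rV_consS /= /bump/= !add1n ltnS; exact: xy.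
(* No coordinate precedes the first one, so its displacement is the same at all points and may be
   read off at 0. *)
pose c : R := T 0 0 ord0.
have cE t y : T (rV_cons (t, y)) 0 ord0 = t + c.
  rewrite /c; have := tT ord0 (rV_cons (t, y)) 0; rewrite rV_cons0 mxE subr0 => <- //.
  by rewrite addrC subrK.
(* The measure in dimension [N.+1] unfolds to the integral over [t] of the measures of the slices; a
   slice is empty unless [t + c] is within [a ord0] of 0. *)
rewrite [LHS](_ : _ = (\int[@lebesgue_measure R]_(t in `](- a ord0 - c)%R, (a ord0 - c)%R[)
    (\prod_j (2 * a (lift ord0 j)))%R%:E)%E); last first.
  rewrite integral_mkcond/=; apply: eq_integral => t _.
  rewrite /= patchE; case: ifPn => [|tA].
    rewrite inE/= in_itv/= => /andP[t1 t2].
    rewrite -(IH _ _ (mTt t) (tTt t) (fun j => a0 _)).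
    congr (lebesgue_rV _ _); apply/seteqP; split => y; rewrite /xsection/= inE/=.
      by move=> h j; rewrite TtE.
    move=> h j; have [i ->|->] := unliftP ord0 j; first by rewrite -TtE.
    by rewrite cE ltr_norml; apply/andP; split; lra.
  rewrite [X in lebesgue_rV _ X](_ : _ = set0) ?measure0//.
  apply/seteqP; split => // y; rewrite /xsection/= inE/= => /(_ ord0).
  rewrite cE ltr_norml => /andP[t1 t2]; move/negP: tA; apply.
  by rewrite inE/= in_itv/=; apply/andP; split; lra.
rewrite integral_cst//= lebesgue_measure_itv/= lte_fin ifT; last first.
  by have := a0 ord0; lra.
rewrite -EFinB -EFinM big_ord_recl mulrC; congr EFin; congr (_ * _).
by ring.
Qed.

(** Two points that agree before [j] are joined by changing the coordinates [m >= j] one at a time;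
    only the change at [m = j] is seen by the [j]-th coordinate of [T]. *)
Lemma triangular_deltaP N (T : 'rV[R]_N -> 'rV[R]_N) :
  (forall (x : 'rV[R]_N) (j m : 'I_N) (a : R), (j <= m)%N ->
    T (x + a *: delta_mx 0 m) 0 j = T x 0 j + a * (j == m)%:R) ->
  triangular T.
Proof.
move=> HT j y z yz.
have H (s : seq 'I_N) (c : 'I_N -> R) :
    T (y + \sum_(m <- s | (j <= m)%N) c m *: delta_mx 0 m) 0 j =
    T y 0 j + \sum_(m <- s | (j <= m)%N) c m * (j == m)%:R.
  elim: s => [|m s IH]; first by rewrite !big_nil !addr0.
  rewrite !big_cons; case: ifPn => // jm.
  by rewrite [X in y + X]addrC addrA HT// IH addrAC addrA.
pose c m := z 0 m - y 0 m.
have zE : y + \sum_(m < N | (j <= m)%N) c m *: delta_mx 0 m = z.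
  apply/rowP => m; rewrite mxE summxE.
  have [jm|mj] := leqP j m; last first.
    rewrite big1 ?addr0; first by rewrite yz.
    move=> i ji; rewrite !mxE eqxx/=; case: eqVneq => [mi|]; last by rewrite mulr0.
    by move: mj; rewrite mi ltnNge ji.
  rewrite (bigD1 m)//= big1 ?addr0; last first.
    by move=> i /andP[_ im]; rewrite !mxE eq_sym (negPf im) andbF mulr0.
  by rewrite !mxE !eqxx mulr1 addrC subrK.
rewrite -zE H zE (bigD1 j)//= big1 ?addr0; last first.
  by move=> m /andP[_ mj]; rewrite eq_sym (negPf mj) mulr0.
by rewrite eqxx mulr1 /c; ring.
Qed.

End triangular_maps.

(** The coordinates are listed by increasing layer, so [j <= m] gives the inequality of weights that
    [sg_op_addr] asks for. *)
Lemma triangular_sg_op (R : realType) k (n : 'I_k -> nat)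
  (G : stratified_group R n) (x : 'rV[R]_(\sum_i n i)) : triangular (sg_op G x).
Proof.
by apply: triangular_deltaP => y j m a jm; rewrite sg_op_addr// le_weight.
Qed.

(** * Boxes in stratified groups *)

Lemma continuous_curry_r (S T U : topologicalType) (f : S * T -> U) (x : S) :
  continuous f -> continuous (fun y => f (x, y)).
Proof.
move=> cf y; apply: (cvg_comp _ f _ (cf (x, y))).
have c1 : x @[z --> y] --> x by exact: cvg_cst.
exact: (cvg_pair c1 cvg_id).
Qed.

Lemma continuous_swap_comp (S T T' U : topologicalType) (g : T -> T')
    (f : T' * S -> U) :
  continuous g -> continuous f -> continuous (fun xy : S * T => f (g xy.2, xy.1)).
Proof.
move=> cg cf [x y]; apply: (cvg_comp _ f _ (cf (g y, x))).
have c1 : z.1 @[z --> (x, y)] --> x by exact: cvg_fst.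
have c2 : g z.2 @[z --> (x, y)] --> g y by apply: (cvg_comp _ g cvg_snd); exact: cg.
exact: (cvg_pair c2 c1).
Qed.

(** * Borel sets of products *)

Section borel_rV.
Context {R : realType}.

Lemma continuous_measurable_rV a b (f : 'rV[R]_a -> 'rV[R]_b) :
  continuous f -> measurable_fun setT f.
Proof.
move=> cf; apply: (@measurability _ _ _ _ _ _ (@open 'rV[R]_b)) => //.
move=> _ [U oU <-]; rewrite setTI; apply: open_measurable_mx.
by move/continuousP : cf; exact.
Qed.

(** The product carries the product sigma-algebra, so an open set is written as a countable union of
    products of balls with rational centres and radii. Products that leave [U] are replaced by the
    empty set to keep a countable index type. *)
Lemma open_measurable_rV_prod a b (U : set ('rV[R]_a * 'rV[R]_b)) :
  open U -> measurable U.
Proof.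
move=> oU.
pose B m (cq : 'rV[rat]_m * rat) : set 'rV[R]_m :=
  ball (map_mx ratr cq.1 : 'rV[R]_m) (ratr cq.2).
pose F (e : ('rV[rat]_a * rat) * ('rV[rat]_b * rat)) :=
  if pselect (B a e.1 `*` B b e.2 `<=` U) then B a e.1 `*` B b e.2 else set0.
have -> : U = \bigcup_e F e.
  apply/seteqP; split => [[x y] Uxy|xy [e _]]; last first.
    by rewrite /F; case: pselect => // BU /BU.
  have /(nbhs_interior)[[A C] /= [Ax Cy] ACU] : nbhs (x, y) U.
    exact: open_nbhs_nbhs.
  have [c [q [cx cA]]] := rV_rat_ball (@open_interior _ A) Ax.
  have [c' [q' [cy cC]]] := rV_rat_ball (@open_interior _ C) Cy.
  exists ((c, q), (c', q')) => //; rewrite /F; case: pselect => //; apply.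
  move=> [x' y'] [/= Bx' By'].
  apply: (interior_subset (ACU (x', y') _)); split => /=.
    exact: interior_subset (cA _ Bx').
  exact: interior_subset (cC _ By').
apply: countable_bigcupT_measurable; first exact: countableP.
move=> e; rewrite /F.
destruct (pselect _); last exact: measurable0.
by apply: measurableX; apply: open_measurable_mx; exact: ball_open.
Qed.

Lemma continuous_measurable_rV_prod a b (f : 'rV[R]_a * 'rV[R]_b -> R) :
  continuous f -> measurable_fun setT f.
Proof.
move=> cf; apply: (@measurability _ _ _ _ _ _ (@RGenOpens.G R)).
  exact: RGenOpens.measurableE.
move=> _ [_ [c [d ->] <-]]; rewrite setTI; apply: open_measurable_rV_prod.
by move/continuousP : cf; apply; exact: interval_open.
Qed.

End borel_rV.

Lemma open_rV_box (R : realType) m (c : 'I_m -> R) :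
  open [set x : 'rV[R]_m | forall j, `|x 0 j| < c j].
Proof.
rewrite openE => x xc.
have H (j : 'I_m) : nbhs x (fun y : 'rV[R]_m => `|y 0 j| < c j).
  by have /cvg_norm/cvgr_lt := @coord_continuous R 1 m 0 j x; apply; exact: xc.
exact: (@filter_forall _ _ _ _ (nbhs_filter x) H).
Qed.

Lemma prod_weighted (R : comNzRingType) N (w : 'I_N -> nat) (c rho : R) :
  \prod_j (c * rho ^+ w j) = c ^+ N * rho ^+ (\sum_j w j).
Proof. by rewrite big_split/= prodr_const card_ord prodrXr. Qed.

Section boxes.
Context {R : realType} {k : nat} {n : 'I_k -> nat}.
Variables (G : stratified_group R n) (N : 'rV[R]_(\sum_i n i) -> R).
Local Notation V := 'rV[R]_(\sum_i n i).
Implicit Types x y z : V.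

Definition sg_dist x y := N (sg_op G (sg_inv G y) x).

(* Boxes replace balls: their measure is computed coordinatewise. *)
Definition sg_box (d : R) z rho : set V :=
  [set x | forall j, `|sg_op G (sg_inv G z) x 0 j| < d * rho ^+ weight j].

Lemma continuous_sg_opl x : continuous (sg_op G x).
Proof.
exact: (@continuous_curry_r _ _ _ _ x (continuous_sg_op G)).
Qed.

Lemma sg_box_center d z rho : 0 < d -> 0 < rho -> sg_box d z rho z.
Proof.
by move=> d0 rho0 j; rewrite sg_opVx mxE normr0 mulr_gt0// exprn_gt0.
Qed.

Lemma open_sg_box d z rho : open (sg_box d z rho).
Proof.
have /continuousP copl := @continuous_sg_opl (sg_inv G z).
exact: (copl _ (@open_rV_box _ _ (fun j => d * rho ^+ weight j))).
Qed.

Lemma measurable_sg_box d z rho : measurable (sg_box d z rho).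
Proof. by apply: open_measurable_mx; exact: open_sg_box. Qed.

Lemma lebesgue_sg_box d z rho : 0 < d -> 0 < rho ->
  lebesgue_rV (\sum_i n i) (sg_box d z rho) =
  ((2 * d) ^+ (\sum_i n i) * rho ^+ homogeneous_dim n)%:E.
Proof.
move=> d0 rho0; rewrite -sum_weight -prod_weighted lebesgue_rV_triangular.
- by congr EFin; apply: eq_bigr => j _; rewrite mulrA.
- by apply: continuous_measurable_rV; exact: continuous_sg_opl.
- exact: triangular_sg_op.
- by move=> j; rewrite mulr_gt0// exprn_gt0.
Qed.

Hypothesis hN : homogeneous_norm G N.

Lemma sg_invK : involutive (sg_inv G).
Proof.
move=> x; rewrite -[LHS](sg_opx0 G) -(sg_opVx G x) sg_opA sg_opVx.
by rewrite sg_op0x.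
Qed.

Lemma sg_invM x y : sg_inv G (sg_op G x y) = sg_op G (sg_inv G y) (sg_inv G x).
Proof.
rewrite -[LHS](sg_opx0 G) -(sg_opxV G x) -{2}(sg_opx0 G x) -(sg_opxV G y).
by rewrite !sg_opA -(sg_opA G _ x y) sg_opVx sg_op0x.
Qed.

Lemma sg_dist_ge0 x y : 0 <= sg_dist x y. Proof. exact: hn_ge0 hN _. Qed.

Lemma sg_dist_sym x y : sg_dist x y = sg_dist y x.
Proof. by rewrite /sg_dist -(hn_inv hN) sg_invM sg_invK. Qed.

Lemma sg_dist_triangle z x y : sg_dist x y <= sg_dist x z + sg_dist z y.
Proof. exact: hn_triangle hN _ _ _. Qed.

Lemma sg_dist_eq0 x y : sg_dist x y = 0 -> x = y.
Proof.
move/(hn_eq0 hN) => /(congr1 (sg_op G y)).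
by rewrite sg_opA sg_opxV sg_op0x sg_opx0.
Qed.

Lemma measurable_sg_dist : measurable_fun setT (fun xy : V * V => sg_dist xy.1 xy.2).
Proof.
apply: continuous_measurable_rV_prod.
have copV : continuous (fun xy : V * V => sg_op G (sg_inv G xy.2) xy.1).
  exact: (@continuous_swap_comp _ _ _ _ _ _ (continuous_sg_inv G) (continuous_sg_op G)).
have cN : continuous N := hn_continuous hN.
by move=> xy; exact: (cvg_comp _ _ (copV xy) (cN _)).
Qed.

(** Dilating by [rho^-1] reduces to size 1, where [d] comes from the continuity of [N] at 0: [N < 1]
    on the sup-norm ball of radius [d]. *)
Lemma sg_box_dist : exists2 d : R, 0 < d & forall z rho x, 0 < rho ->
  sg_box d z rho x -> sg_dist x z < rho.
Proof.
have cN : continuous N := hn_continuous hN.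
have N0 : N 0 = 0 by apply/(hn_eq0 hN).
have : nbhs (0 : V) (fun x => N x < 1).
  by have /cvgr_lt := cN 0; rewrite N0; apply.
move=> /nbhs_ballP[d /= d0 dN]; exists d => // z rho x rho0 xz.
have -> : sg_dist x z =
    rho * N (dilation rho^-1 (sg_op G (sg_inv G z) x)).
  by rewrite -(hn_dilation hN)// dilationM divff ?gt_eqF// dilation1.
rewrite gtr_pMr//; apply: dN; split => // i j.
rewrite (ord1 i) mxE dilationE /ball/= sub0r normrN normrM.
rewrite normrX gtr0_norm ?invr_gt0// exprVn mulrC.
by rewrite ltr_pdivrMr ?exprn_gt0//; exact: xz.
Qed.

End boxes.

(** * The critical embedding in metric measure spaces *)

Section integral_bounds.
Context d {T : measurableType d} {R : realType}.
Variable mu : {measure set T -> \bar R}.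

(** Markov's inequality, for any set on which [f] is at least [c]. *)
Lemma integral_ge_cst (f : T -> \bar R) (A : set T) (c : R) :
  measurable A -> measurable_fun setT f -> (forall x, 0 <= f x)%E -> 0 <= c ->
  (forall x, A x -> c%:E <= f x)%E ->
  (c%:E * mu A <= \int[mu]_x f x)%E.
Proof.
move=> mA mf f0 c0 cf; rewrite -integral_cst//.
apply: (@le_trans _ _ (\int[mu]_(x in A) f x)%E).
  apply: ge0_le_integral => //; apply: measurable_funTS => //.
by apply: ge0_subset_integral.
Qed.

Lemma nneseries_le (f : nat -> \bar R) (c : \bar R) : (forall k, 0 <= f k)%E ->
  (forall n, \sum_(0 <= k < n) f k <= c)%E -> (\sum_(k <oo) f k <= c)%E.
Proof.
move=> f0 fc; apply: lime_le; first exact: is_cvg_nneseries.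
by apply: nearW => n; exact: fc.
Qed.

End integral_bounds.

(** The growth factors [L / q ^+ k] are at most 1 from [k = n0] on, so at most [n0] steps can
    increase [e], each by a factor at most [max 1 L]. The bound depends on [q] and [L] only. *)
Lemma geometric_domination (R : realType) (q L : R) : 2 <= q -> 0 <= L ->
  exists2 M : R, 0 <= M & forall e : nat -> R, (forall k, 0 <= e k) -> e 0%N <= 1 ->
    (forall k, e k.+1 <= L / q ^+ k * e k) -> forall k, e k <= M.
Proof.
move=> q2 L0; have q0 : 0 < q by lra.
(* Any [n0] with [L <= q ^+ n0] would do; here [L < n0 < 2 ^ n0 <= q ^ n0]. *)
pose n0 := (Num.truncn L).+1.
have n0L : L <= q ^+ n0.
  apply: (@le_trans _ _ n0%:R); first exact/ltW/truncnS_gt.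
  apply: (@le_trans _ _ (2 ^+ n0)); last by rewrite lerXn2r// nnegrE; lra.
  by rewrite -natrX ler_nat ltnW// ltn_expl.
pose M := Num.max 1 L; have M1 : 1 <= M by rewrite le_max lexx.
exists (M ^+ n0); first by rewrite exprn_ge0//; lra.
move=> e e0 e01 eS k.
suff H : e k <= M ^+ minn k n0.
  by apply: (le_trans H); rewrite ler_weXn2l// geq_minr.
elim: k => [|k IH]; first by rewrite min0n expr0.
have [kn|nk] := ltnP k n0.
  rewrite (minn_idPl _)// exprS; apply: (le_trans (eS k)).
  rewrite (minn_idPl (ltnW kn)) in IH.
  apply: ler_pM => //; first by rewrite divr_ge0// exprn_ge0// ltW.
  apply: (@le_trans _ _ L); last by rewrite le_max lexx orbT.
  by rewrite ler_pdivrMr ?exprn_gt0// ler_peMr// exprn_ege1//; lra.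
rewrite (minn_idPr (leqW nk)); rewrite (minn_idPr nk) in IH.
apply: le_trans IH; apply: (le_trans (eS k)).
rewrite -[leRHS]mul1r; apply: ler_wpM2r => //.
rewrite ler_pdivrMr ?exprn_gt0// mul1r (le_trans n0L)//.
by rewrite ler_weXn2l//; lra.
Qed.

(** * Metric measure spaces with boxes *)

Section metric_boxes.
Context d {T : measurableType d} {R : realType}.

(** What the analysis retains of the group: a measurable distance and, at every point and scale, a
    set contained in the ball whose measure is exactly [om * rho ^ Q]. *)
Record metric_boxes (mu : set T -> \bar R) (dist : T -> T -> R) (Q om : R)
    (box : T -> R -> set T) : Prop := {
  mb_Q_gt0 : 0 < Q ;
  mb_om_gt0 : 0 < om ;
  mb_dist_ge0 : forall x y, 0 <= dist x y ;
  mb_dist_eq0 : forall x y, dist x y = 0 -> x = y ;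
  mb_dist_sym : forall x y, dist x y = dist y x ;
  mb_dist_triangle : forall z x y, dist x y <= dist x z + dist z y ;
  mb_measurable_dist : measurable_fun setT (fun xy : T * T => dist xy.1 xy.2) ;
  mb_measurable_box : forall z rho, 0 < rho -> measurable (box z rho) ;
  mb_measure_box : forall z rho, 0 < rho -> mu (box z rho) = (om * rho `^ Q)%:E ;
  mb_box_dist : forall z rho x, 0 < rho -> box z rho x -> dist x z < rho }.

Variables (mu : {sigma_finite_measure set T -> \bar R}) (dist : T -> T -> R).
Variables (Q om : R) (box : T -> R -> set T).
Hypothesis mb : metric_boxes mu dist Q om box.
Variable p : R.
Hypothesis p_ge1 : 1 <= p.
Implicit Types (u : T -> R) (x y z : T).

Let p_ge0 : 0 <= p. Proof. exact: le_trans ler01 p_ge1. Qed.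

(** Inner integral of the [p]-th power of the Gagliardo seminorm in the critical case, where the
    exponent [Q + p * s] is [Q + Q]. *)
Definition energy_at u y : \bar R :=
  (\int[mu]_x (`|u x - u y| `^ p / dist x y `^ (Q + Q))%:E)%E.

Definition energy u : \bar R := (\int[mu]_y energy_at u y)%E.

Lemma energy_at_ge0 u y : (0 <= energy_at u y)%E.
Proof.
by apply: integral_ge0 => x _; rewrite lee_fin divr_ge0 ?powR_ge0.
Qed.

Lemma measurable_quotient u : measurable_fun setT u ->
  measurable_fun setT (fun xy : T * T =>
    (`|u xy.1 - u xy.2| `^ p / dist xy.1 xy.2 `^ (Q + Q))%:E).
Proof.
move=> mu_; apply/measurable_EFinP; apply: measurable_funM.
  apply: (measurableT_comp (measurable_powR _)).
  apply: measurableT_comp => //; apply: measurable_funB.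
    exact: measurableT_comp.
  exact: measurableT_comp.
under eq_fun do rewrite -powRN.
apply: (measurableT_comp (measurable_powR _)).
exact: mb_measurable_dist mb.
Qed.

Lemma measurable_energy_at u : measurable_fun setT u ->
  measurable_fun setT (energy_at u).
Proof.
move=> mu_.
apply: (@measurable_fun_fubini_tonelli_G _ _ _ _ _ mu
  (fun xy : T * T => (`|u xy.1 - u xy.2| `^ p / dist xy.1 xy.2 `^ (Q + Q))%:E)).
  exact: measurable_quotient.
by move=> xy; rewrite lee_fin divr_ge0 ?powR_ge0.
Qed.

(** A part of measure at least [a] of the box of measure [2 * a] at [y] lies outside the superlevel
    set. There the numerator is at least [t ^ p] and the denominator at most [rho ^ (2 Q)], that is
    [(2 * a / om) ^ 2]. *)
Lemma energy_at_ge u (t a : R) y : measurable_fun setT u -> 0 < t -> 0 < a ->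
  mu [set x | t < `|u x|] = a%:E -> 2 * t < `|u y| ->
  ((t `^ p * (om ^+ 2 / 4) / a)%:E <= energy_at u y)%E.
Proof.
move=> mu_ t0 a0 Ea uy.
have Q0 := mb_Q_gt0 mb; have QQ0 : 0 <= Q + Q by rewrite addr_ge0// ltW.
have om0 := mb_om_gt0 mb.
(* The size for which the box has measure [2 * a]. *)
pose rho := (2 * a / om) `^ Q^-1.
have rho0 : 0 < rho by rewrite powR_gt0// divr_gt0// mulr_gt0.
have rhoQ : rho `^ Q = 2 * a / om.
  by rewrite -powRrM mulVf ?gt_eqF// powRr1// divr_ge0 ?mulr_ge0// ltW.
set E := [set x | _] in Ea.
have mE : measurable E.
  rewrite /E -[X in measurable X]setTI.
  apply: (measurable_fun_ltr (measurable_cst t)) => //.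
  by apply: measurableT_comp.
have mB := mb_measurable_box mb y rho0.
have BE : (a%:E <= mu (box y rho `\` E))%E.
  have : (mu (box y rho) <= mu (box y rho `\` E) + mu E)%E.
    have mBE := measurableD mB mE.
    apply: (@le_trans _ _ (mu ((box y rho `\` E) `|` E))); last exact: measureU2.
    apply: le_measure; rewrite ?inE//; first exact: measurableU.
    by move=> x Bx; have [Ex|nEx] := pselect (E x); [right|left].
  rewrite (mb_measure_box mb)// rhoQ Ea.
  have -> : om * (2 * a / om) = a + a by field; rewrite gt_eqF.
  by rewrite EFinD leeD2rE.
apply: (@le_trans _ _ ((t `^ p / rho `^ (Q + Q))%:E * mu (box y rho `\` E))%E).
  apply: (@le_trans _ _ ((t `^ p / rho `^ (Q + Q))%:E * a%:E)%E); last first.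
    by apply: lee_wpmul2l => //; rewrite lee_fin divr_ge0 ?powR_ge0.
  rewrite -EFinM lee_fin powRD ?rhoQ; last by rewrite gt_eqF ?implybT// addr_gt0.
  by rewrite le_eqVlt; apply/orP; left; apply/eqP; field; rewrite !gt_eqF.
apply: integral_ge_cst => //.
- exact: measurableD.
- by apply: measurable_fun_pair1 (measurable_quotient mu_).
- by move=> x; rewrite lee_fin divr_ge0 ?powR_ge0.
- by rewrite divr_ge0 ?powR_ge0.
move=> x [Bx nEx]; rewrite lee_fin; apply: ler_pM.
- exact: powR_ge0.
- by rewrite invr_ge0 powR_ge0.
- apply: ge0_ler_powR; rewrite ?nnegrE ?(ltW t0)//.
  have ux : `|u x| <= t by rewrite leNgt; exact/negP.
  by have := lerB_dist (u y) (u x); rewrite distrC => h; lra.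
(* The point [y] lies in [E] and [x] does not, so [x] is off the diagonal and the denominator is
   positive. *)
have xy : x <> y by move=> xy; apply: nEx; rewrite xy /E/=; move: uy; lra.
have dxy : 0 < dist x y.
  rewrite lt_neqAle (mb_dist_ge0 mb) andbT eq_sym; apply/eqP => /(mb_dist_eq0 mb).
  exact.
rewrite lef_pV2 ?posrE; [|exact: powR_gt0|exact: powR_gt0].
apply: ge0_ler_powR; rewrite ?nnegrE ?(ltW dxy) ?(ltW rho0)//.
by apply/ltW/(mb_box_dist mb).
Qed.

End metric_boxes.

(** * Decay of the superlevel sets *)

Section critical_embedding.
Context d {T : measurableType d} {R : realType}.
Variables (mu : {sigma_finite_measure set T -> \bar R}) (dist : T -> T -> R).
Variables (Q om : R) (box : T -> R -> set T).
Hypothesis mb : metric_boxes mu dist Q om box.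
Variable p : R.
Hypothesis p_ge1 : 1 <= p.
Implicit Types (u : T -> R) (x y z : T).

Let p_ge0 : 0 <= p. Proof. exact: le_trans ler01 p_ge1. Qed.

Lemma measurable_superlevel u (t : R) : measurable_fun setT u ->
  measurable [set x | t < `|u x|].
Proof.
move=> mu_; rewrite -[X in measurable X]setTI.
apply: (measurable_fun_ltr (measurable_cst t)) => //.
by apply: measurableT_comp.
Qed.

Lemma measurable_powR_norm u (r : R) : measurable_fun setT u ->
  measurable_fun setT (fun x => (`|u x| `^ r)%:E).
Proof.
move=> mu_; apply/measurable_EFinP; apply: (measurableT_comp (measurable_powR _)).
exact: measurableT_comp.
Qed.

(** The lower bound of [energy_at_ge] is integrated over the points where [|u| > 2 t]. *)
Lemma superlevel_halving u (t : R) : measurable_fun setT u -> 0 < t ->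
  (mu [set x | (t < `|u x|)%R] < +oo)%E ->
  ((t `^ p * (om ^+ 2 / 4))%:E * mu [set x | (2 * t < `|u x|)%R] <=
    energy mu dist Q p u * mu [set x | (t < `|u x|)%R])%E.
Proof.
move=> mu_ t0 Eoo.
have Efin : mu [set x | t < `|u x|] \is a fin_num by rewrite ge0_fin_numE.
have [a Ea] : exists a, mu [set x | t < `|u x|] = a%:E.
  by exists (fine (mu [set x | t < `|u x|])); rewrite fineK.
have a_ge0 : 0 <= a by rewrite -lee_fin -Ea.
have E20 : (mu [set x | (2 * t < `|u x|)%R] <= mu [set x | (t < `|u x|)%R])%E.
  apply: le_measure; rewrite ?inE; [exact: measurable_superlevel..|].
  by move=> x /=; lra.
(* The bound divides by [a]; for [a = 0] the smaller superlevel set is null as well. *)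
have [a0|a0] := eqVneq a 0.
  rewrite Ea a0 in E20 *; rewrite mule0.
  have -> : mu [set x | (2 * t < `|u x|)%R] = 0%E.
    by apply/eqP; rewrite eq_le E20 measure_ge0.
  by rewrite mule0.
have {}a0 : 0 < a by rewrite lt_neqAle eq_sym a0.
rewrite Ea -lee_pdivrMr// muleAC -EFinM.
apply: integral_ge_cst.
- exact: measurable_superlevel.
- exact: measurable_energy_at mb _ _ mu_.
- exact: energy_at_ge0.
- by rewrite !mulr_ge0 ?powR_ge0 ?invr_ge0 ?exprn_ge0 ?(ltW a0)// ltW// (mb_om_gt0 mb).
by move=> y uy; exact: (energy_at_ge mb p_ge1 mu_ t0 a0 Ea uy).
Qed.

(** [k] is the predecessor of the least [m] with [a <= lam * 2 ^+ m]; this [m] is positive because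
    [lam < a]. *)
Lemma dyadic_level (lam a : R) : 0 < lam -> lam < a ->
  exists k : nat, lam * 2 ^+ k < a <= 2 * (lam * 2 ^+ k).
Proof.
move=> lam0 lama.
have [m am] : exists m, a <= lam * 2 ^+ m.
  exists (Num.truncn (a / lam)).+1.
  rewrite mulrC -ler_pdivrMr//; apply: (@le_trans _ _ (Num.truncn (a / lam)).+1%:R).
    exact/ltW/truncnS_gt.
  by rewrite -natrX ler_nat ltnW// ltn_expl.
have := ex_minnP (ex_intro (fun m => a <= lam * 2 ^+ m) m am).
case => -[|k] ak kmin; first by move: ak; rewrite expr0 mulr1 leNgt lama.
exists k; rewrite mulrCA -exprS ak andbT ltNge; apply/negP => /kmin.
by rewrite ltnn.
Qed.

(** Below the level [lam], [|u|^r] is at most [lam^(r-p) |u|^p]. Above it, [|u|^r] is bounded on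
    dyadic layers, and the measures of the superlevel sets decay fast enough to sum the series. *)
Lemma critical_bound (r : R) : p <= r -> exists2 C : R, 0 < C &
  forall u (lam : R), measurable_fun setT u -> 0 < lam ->
  (\int[mu]_x (`|u x| `^ p)%:E <= (lam `^ p)%:E)%E ->
  (energy mu dist Q p u <= (lam `^ p)%:E)%E ->
  (\int[mu]_x (`|u x| `^ r)%:E <= (C * lam `^ r)%:E)%E.
Proof.
move=> pr; have om0 := mb_om_gt0 mb.
have r_ge0 : 0 <= r := le_trans p_ge0 pr.
pose q : R := 2 `^ p; pose g : R := 2 `^ r.
have q2 : 2 <= q.
  by rewrite -[leLHS]powRr1// ler_powR//; lra.
have g0 : 0 < g by exact: powR_gt0.
(* Inverse of the constant [om ^+ 2 / 4] of [superlevel_halving]. *)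
pose K := (4 / om ^+ 2); have K0 : 0 < K by rewrite divr_gt0// exprn_gt0.
(* [2 * g * K] is the constant in the recursion for the rescaled measures [g ^+ k * a k * 2 ^+ k]
   below. *)
have L0 : 0 <= 2 * g * K by apply: ltW; rewrite mulr_gt0 // mulr_gt0.
have [M M0 HM] := geometric_domination q2 L0.
(* The 1 pays for the values up to [lam]. In the other term, [g] comes from the upper end of a
   dyadic layer and the last 2 from the sum of the [2 ^- k]. *)
exists (1 + g * (M * 2)); first by rewrite ltr_wpDr ?mulr_ge0 ?(ltW g0).
move=> u lam mu_ lam0 up eu.
have lamp0 : 0 < lam `^ p by exact: powR_gt0.
pose A k := [set x | lam * 2 ^+ k < `|u x|].
have mA k : measurable (A k) by exact: measurable_superlevel.
have A01 : (mu (A 0%N) <= 1)%E.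
  rewrite -(@lee_pmul2l _ (lam `^ p)%:E)// mule1; apply: le_trans up.
  apply: integral_ge_cst => //.
  - exact: measurable_powR_norm.
  - exact: ltW.
  move=> x; rewrite /A/= expr0 mulr1 => ux.
  by rewrite lee_fin ge0_ler_powR ?nnegrE// ltW.
have A1 k : (mu (A k) <= 1)%E.
  apply: le_trans A01; apply: le_measure; rewrite ?inE// => x; rewrite /A/= expr0 mulr1.
  by apply: le_lt_trans; rewrite ler_peMr ?exprn_ege1 ?(ltW lam0)//; lra.
pose a k := fine (mu (A k)).
have aE k : mu (A k) = (a k)%:E.
  by rewrite fineK// ge0_fin_numE// (le_lt_trans (A1 k))// ltry.
have a_ge0 k : 0 <= a k by rewrite fine_ge0.
(* At [t = lam * 2 ^+ k] the factor [t ^ p] equals [lam ^ p * q ^+ k], and [lam ^ p] cancels against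
   the bound on the energy. *)
have aS k : a k.+1 <= K / q ^+ k * a k.
  have l2k : 0 < lam * 2 ^+ k by rewrite mulr_gt0// exprn_gt0.
  have ASk : [set x | 2 * (lam * 2 ^+ k) < `|u x|] = A k.+1.
    by rewrite /A exprS mulrCA.
  have H := superlevel_halving mu_ l2k.
  rewrite ASk -/(A k) !aE in H; have {}H := H (ltry _).
  have {}H : (lam * 2 ^+ k) `^ p * (om ^+ 2 / 4) * a k.+1 <= lam `^ p * a k.
    rewrite -lee_fin EFinM (le_trans H)// EFinM.
    by apply: lee_wpmul2r => //; rewrite lee_fin.
  rewrite powRM ?exprn_ge0 ?(ltW lam0)// in H.
  have q2k : (2 ^+ k) `^ p = q ^+ k :> R.
    by rewrite -powR_mulrn// -powRrM mulrC powRrM powR_mulrn ?powR_ge0.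
  rewrite q2k -!mulrA ler_pM2l// in H.
  rewrite -(@ler_pM2l _ (q ^+ k * (om ^+ 2 / 4))); last first.
    by rewrite mulr_gt0 ?exprn_gt0 ?divr_gt0 ?exprn_gt0//; lra.
  rewrite -mulrA mulrA (le_trans _ (le_trans H _))//; first by rewrite !mulrA.
  rewrite /K le_eqVlt; apply/orP; left; apply/eqP; field.
  by rewrite !gt_eqF//= exprn_gt0//; lra.
have aM k : g ^+ k * a k <= M / 2 ^+ k.
  rewrite ler_pdivlMr ?exprn_gt0//.
  (* The extra factor [2 ^+ k] turns a bound on [e] into the summable bound [M / 2 ^+ k]. *)
  pose e k := g ^+ k * a k * 2 ^+ k.
  apply: (HM e) => [i||i].
  - by rewrite /e !mulr_ge0// exprn_ge0// ltW.
  - by rewrite /e !expr0 mul1r mulr1 -lee_fin -aE.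
  rewrite /e !exprS (_ : _ / _ * _ = g * g ^+ i * (2 * 2 ^+ i) * (K / q ^+ i * a i)).
    rewrite mulrAC; apply: ler_wpM2l => //.
    by rewrite !mulr_ge0 ?exprn_ge0// ltW.
  by ring.
pose f k x := ((lam * 2 ^+ k.+1) `^ r * \1_(A k) x)%:E.
have f0 k x : (0 <= f k x)%E by rewrite lee_fin mulr_ge0 ?powR_ge0.
have mf k : measurable_fun setT (f k).
  apply/measurable_EFinP; apply: measurable_funM => //.
have fI k : (\int[mu]_x f k x = ((lam * 2 ^+ k.+1) `^ r * a k)%:E)%E.
  under eq_integral do rewrite /f EFinM.
  rewrite ge0_integralZl//.
  - by rewrite integral_indic// setIT EFinM -aE.
  - exact/measurable_EFinP.
  - by rewrite lee_fin powR_ge0.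
have uf x : ((`|u x| `^ r)%:E <=
    (lam `^ (r - p) * `|u x| `^ p)%:E + \sum_(k <oo) f k x)%E.
  have s0 : (0 <= \sum_(k <oo) f k x)%E by apply: nneseries_ge0.
  have [ul|lu] := leP `|u x| lam.
    apply: le_trans (leeDl _ s0); rewrite lee_fin.
    have [->|ux0] := eqVneq `|u x| 0.
      rewrite powR0 ?mulr_ge0 ?powR_ge0// gt_eqF// (lt_le_trans _ pr)//.
      exact: lt_le_trans p_ge1.
    have -> : `|u x| `^ r = `|u x| `^ (r - p) * `|u x| `^ p.
      by rewrite -powRD ?subrK// ux0 implybT.
    apply: ler_wpM2r; first exact: powR_ge0.
    by rewrite ge0_ler_powR ?nnegrE ?subr_ge0 ?(ltW lam0).
  have [k /andP[k1 k2]] := dyadic_level lam0 lu.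
  (* The single term of the layer containing [|u x|] suffices, the others being nonnegative. *)
  apply: (@le_trans _ _ (f k x)).
    rewrite lee_fin indicE mem_set// mulr1 exprS mulrCA.
    by rewrite ge0_ler_powR ?nnegrE// mulr_ge0// mulr_ge0 ?exprn_ge0// ltW.
  apply: (@le_trans _ _ (\sum_(k <oo) f k x)%E); last first.
    by apply: leeDr; rewrite lee_fin mulr_ge0 ?powR_ge0.
  apply: le_trans (nneseries_lim_ge k.+1 _); last by [].
  by rewrite big_nat_recr//= leeDr// sume_ge0.
have mlam : measurable_fun setT (fun x => (lam `^ (r - p) * `|u x| `^ p)%:E).
  apply/measurable_EFinP; apply: measurable_funM => //.
  exact/measurable_EFinP/measurable_powR_norm.
have mS : measurable_fun setT (fun x => \sum_(k <oo) f k x)%E.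
  exact: (@ge0_emeasurable_sum _ _ _ _ f xpredT).
apply: (@le_trans _ _ (\int[mu]_x ((lam `^ (r - p) * `|u x| `^ p)%:E +
    \sum_(k <oo) f k x))%E).
  apply: ge0_le_integral => //.
  - exact: measurable_powR_norm.
  - exact: emeasurable_funD.
rewrite ge0_integralD//; last first.
  by move=> x _; exact: nneseries_ge0.
  by move=> x _; rewrite lee_fin mulr_ge0 ?powR_ge0.
rewrite mulrDl mul1r EFinD; apply: leeD.
  under eq_integral do rewrite EFinM.
  rewrite ge0_integralZl//; last 2 first.
  - exact: measurable_powR_norm.
  - by rewrite lee_fin powR_ge0.
  apply: (@le_trans _ _ ((lam `^ (r - p))%:E * (lam `^ p)%:E)%E).
    by apply: lee_wpmul2l => //; rewrite lee_fin powR_ge0.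
  by rewrite -EFinM -powRD ?subrK// (gt_eqF lam0) implybT.
rewrite integral_nneseries//.
apply: nneseries_le => [k|m]; first exact: integral_ge0.
under eq_bigr do rewrite fI.
rewrite sumEFin lee_fin.
apply: (@le_trans _ _ (\sum_(0 <= k < m) lam `^ r * g * M * (2 ^+ k)^-1)).
  apply: ler_sum => k _; rewrite powRM ?exprn_ge0 ?(ltW lam0)//.
  rewrite -!mulrA; apply: ler_wpM2l; first exact: powR_ge0.
  have -> : (2 ^+ k.+1) `^ r = g * g ^+ k :> R.
    by rewrite -exprS -powR_mulrn// -powRrM mulrC powRrM powR_mulrn ?powR_ge0.
  by rewrite -!mulrA; apply: ler_wpM2l; [exact: ltW|exact: aM].
rewrite -mulr_sumr.
have -> : \sum_(0 <= k < m) (2 ^+ k)^-1 = 2 - 2 / 2 ^+ m :> R.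
  elim: m => [|m IH]; first by rewrite big_nil expr0 divr1 subrr.
  rewrite big_nat_recr//= IH exprS; field; rewrite gt_eqF ?exprn_gt0//=.
rewrite (_ : g * _ * _ = lam `^ r * g * M * 2); last by ring.
apply: ler_wpM2l; first by rewrite !mulr_ge0 ?powR_ge0// ltW.
by rewrite gerBl divr_ge0// exprn_ge0.
Qed.

End critical_embedding.

(** * Compactness in metric measure spaces *)

(** If [a <= t] the first term alone dominates, otherwise the second: in each case a power of [a] is
    replaced by the same power of [t]. *)
Lemma powR_interpolation (R : realType) (a t q r q' : R) : 0 <= a -> 0 < t ->
  0 < r -> q <= r -> r <= q' ->
  a `^ r <= t `^ (r - q) * a `^ q + t `^ (r - q') * a `^ q'.
Proof.
move=> a0 t0 r0 qr rq'.
have [->|aN0] := eqVneq a 0.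
  by rewrite powR0 ?gt_eqF// addr_ge0// mulr_ge0 ?powR_ge0.
have {}a0 : 0 < a by rewrite lt_neqAle eq_sym aN0.
have split s : a `^ r = a `^ (r - s) * a `^ s.
  by rewrite -powRD ?subrK// aN0 implybT.
have [le_at|lt_ta] := leP a t.
  apply: ler_wpDr; first by rewrite mulr_ge0 ?powR_ge0.
  rewrite (split q); apply: ler_wpM2r; first exact: powR_ge0.
  by rewrite ge0_ler_powR ?nnegrE ?subr_ge0// ltW.
apply: ler_wpDl; first by rewrite mulr_ge0 ?powR_ge0.
rewrite (split q'); apply: ler_wpM2r; first exact: powR_ge0.
rewrite -(opprB q' r) !powRN lef_pV2 ?posrE; [|exact: powR_gt0..].
by rewrite ge0_ler_powR ?nnegrE ?subr_ge0// ltW.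
Qed.

(** * Oscillation on boxes *)

Section box_averages.
Context d {T : measurableType d} {R : realType}.
Variables (mu : {sigma_finite_measure set T -> \bar R}) (dist : T -> T -> R).
Variables (Q om : R) (box : T -> R -> set T).
Hypothesis mb : metric_boxes mu dist Q om box.
Variable p : R.
Hypothesis p_ge1 : 1 <= p.
Implicit Types (u v : T -> R) (x y z : T).

Let p_ge0 : 0 <= p. Proof. exact: le_trans ler01 p_ge1. Qed.

(** From the pointwise bound [|u| <= 1 + |u|^p], the interpolation at [t = 1] between the exponents
    0 and [p]. *)
Lemma integral_norm_le_measure u (D : set T) : measurable D ->
  measurable_fun setT u ->
  (\int[mu]_(x in D) `|(u x)%:E| <= mu D + \int[mu]_x (`|u x| `^ p)%:E)%E.
Proof.
move=> mD mu_.
have mup := measurable_powR_norm p mu_.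
apply: (@le_trans _ _ (\int[mu]_(x in D) (1%:E + (`|u x| `^ p)%:E))%E).
  apply: ge0_le_integral => //.
  - apply: measurable_funTS; apply: measurableT_comp => //.
    exact/measurable_EFinP.

  - apply: measurable_funTS; exact: emeasurable_funD.
  move=> x _; rewrite -EFinD lee_fin.
  have := @powR_interpolation R `|u x| 1 0 1 p (normr_ge0 _) ltr01 ltr01 ler01 p_ge1.
  by rewrite powRr1// !powR1 powRr0 !mul1r.
rewrite ge0_integralD//; last exact: measurable_funTS.
rewrite integral_cst// mul1e leeD2l//.
exact: ge0_subset_integral.
Qed.

(** Left unnormalized: the average multiplied by [om * eps ^ Q]. *)
Definition box_integral z eps u : R := fine (\int[mu]_(x in box z eps) (u x)%:E)%E.

Lemma integrable_box u z eps : 0 < eps -> measurable_fun setT u ->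
  (\int[mu]_x (`|u x| `^ p)%:E < +oo)%E ->
  mu.-integrable (box z eps) (EFin \o u).
Proof.
move=> eps0 mu_ upoo; have mB := mb_measurable_box mb z eps0.
apply/integrableP; split; first by apply/measurable_EFinP/measurable_funTS.
apply: (le_lt_trans (integral_norm_le_measure mB mu_)).
by rewrite (mb_measure_box mb)// lte_add_pinfty// ltry.
Qed.

(** The bound is uniform in [u], so that for a bounded sequence these numbers have a limit along an
    ultrafilter. *)
Lemma box_integral_bounded u z eps (c : R) : 0 < eps -> measurable_fun setT u ->
  (\int[mu]_x (`|u x| `^ p)%:E <= c%:E)%E ->
  `|box_integral z eps u| <= om * eps `^ Q + c.
Proof.
move=> eps0 mu_ upc.
have ui := integrable_box z eps0 mu_ (le_lt_trans upc (ltry c)).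
have mB := mb_measurable_box mb z eps0.
rewrite -lee_fin -abse_EFin fineK; last exact: integrable_fin_num.
apply: le_trans (le_abse_integral _ _ _) _ => //; first by case/integrableP : ui.
apply: (le_trans (integral_norm_le_measure mB mu_)).
by rewrite (mb_measure_box mb)// EFinD leeD2l.
Qed.

(** Pointwise [|u x - u y| <= delta + delta^(1-p) |u x - u y|^p], and two points of the box are at
    distance at most [2 * eps], so the last power is at most [(2 * eps)^(2 Q)] times the quotient in
    the energy. Integrate in [x] over the box. *)
Lemma box_average u z eps delta y : 0 < eps -> 0 < delta ->
  measurable_fun setT u -> (\int[mu]_x (`|u x| `^ p)%:E < +oo)%E ->
  box z eps y ->
  ((`|om * eps `^ Q * u y - box_integral z eps u|)%:E <=
   (delta * (om * eps `^ Q))%:E +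
   (delta `^ (1 - p) * (2 * eps) `^ (Q + Q))%:E * energy_at mu dist Q p u y)%E.
Proof.
move=> eps0 delta0 mu_ upoo yB.
have mB := mb_measurable_box mb z eps0.
have ui := integrable_box z eps0 mu_ upoo.
have muB := mb_measure_box mb z eps0.
have Q0 := mb_Q_gt0 mb.
have QQ0 : 0 <= Q + Q by rewrite addr_ge0// ltW.
have iB : mu.-integrable (box z eps) (EFin \o cst (u y)).
  apply/integrableP; split; first exact/measurable_EFinP.
  by rewrite /= integral_cst// [X in (_ * X)%E]muB -EFinM ltry.
have -> : (`|om * eps `^ Q * u y - box_integral z eps u|)%:E =
    (`|\int[mu]_(x in box z eps) ((u y)%:E - (u x)%:E)|)%E.
  rewrite (integralB_EFin (f1 := cst (u y)) mB iB ui) /= integral_cst// [X in (_ * X)%E]muB.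
  rewrite -[X in (_ - X)%E](fineK (integrable_fin_num mB ui)).
  by rewrite -EFinM -EFinB abse_EFin mulrC.
apply: (@le_trans _ _ (\int[mu]_(x in box z eps) `|(u y)%:E - (u x)%:E|)%E).
  apply: le_abse_integral => //; apply/measurable_EFinP/measurable_funTS.
  exact: measurable_funB.
pose K := delta `^ (1 - p) * (2 * eps) `^ (Q + Q).
have K0 : 0 <= K by rewrite mulr_ge0 ?powR_ge0.
pose g x : R := `|u x - u y| `^ p / dist x y `^ (Q + Q).
have g0 x : 0 <= g x by rewrite divr_ge0 ?powR_ge0.
have mg : measurable_fun setT (EFin \o g).
  exact: measurable_fun_pair1 (measurable_quotient mb p mu_).
apply: (@le_trans _ _ (\int[mu]_(x in box z eps) (delta%:E + K%:E * (g x)%:E))%E).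
  apply: ge0_le_integral => //.
  - apply: measurable_funTS; apply: measurableT_comp => //.
    by apply/measurable_EFinP; exact: measurable_funB.
  - apply: measurable_funTS; apply: emeasurable_funD => //.
    exact: measurable_funeM.
  move=> x xB; rewrite -EFinB abse_EFin -EFinM -EFinD lee_fin distrC.
  have := @powR_interpolation R `|u x - u y| delta 0 1 p (normr_ge0 _) delta0 ltr01
    ler01 p_ge1.
  rewrite subr0 powRr0 mulr1 !powRr1//; last exact: ltW.
  move/le_trans; apply; rewrite lerD2l /K -mulrA; apply: ler_wpM2l; first exact: powR_ge0.
  rewrite /g; have [->|xy] := eqVneq x y.
    rewrite subrr normr0 powR0 ?mul0r ?mulr0// gt_eqF//; exact: lt_le_trans p_ge1.
  have dxy : 0 < dist x y.
    rewrite lt_neqAle (mb_dist_ge0 mb) andbT eq_sym.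
    by apply: contra_neq xy; exact: (mb_dist_eq0 mb).
  rewrite mulrCA -[leLHS]mulr1; apply: ler_wpM2l; first exact: powR_ge0.
  rewrite ler_pdivlMr ?powR_gt0// mul1r ge0_ler_powR ?nnegrE ?(ltW dxy)//.
    by rewrite mulr_ge0// ltW.
  apply: (le_trans (mb_dist_triangle mb z x y)); rewrite (mb_dist_sym mb z y).
  have := mb_box_dist mb eps0 xB; have := mb_box_dist mb eps0 yB; lra.
rewrite ge0_integralD//; last 3 first.
- by move=> x _; rewrite lee_fin ltW.
- by move=> x _; rewrite -EFinM lee_fin mulr_ge0.
- by apply: measurable_funTS; exact: measurable_funeM.
rewrite integral_cst// [X in (_ * X)%E]muB -EFinM leeD2l//.
rewrite ge0_integralZl//; last 2 first.
- exact: measurable_funTS.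
- by move=> x _; rewrite lee_fin.
rewrite lee_wpmul2l ?lee_fin//.
apply: (@ge0_subset_integral _ _ _ mu _ setT mB measurableT (EFin \o g)) => //.
by move=> x _; rewrite lee_fin.
Qed.

End box_averages.

(** * Control of the L^1 distance by box integrals *)

Section L1_estimate.
Context d {T : measurableType d} {R : realType}.
Variables (mu : {sigma_finite_measure set T -> \bar R}) (dist : T -> T -> R).
Variables (Q om : R) (box : T -> R -> set T).
Hypothesis mb : metric_boxes mu dist Q om box.
Variable p : R.
Hypothesis p_ge1 : 1 <= p.
Implicit Types (u v : T -> R) (x y z : T).

(** For [y] in the box at [z], the rescaled difference of [u y] and [v y] splits into the difference
    of the box integrals, at most [eta], and two deviations bounded by [box_average]. *)
Lemma L1_box_estimate (D : set T) (W : R) (F : set T) u v (eps delta eta : R) :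
  measurable D -> mu D = W%:E -> 0 < eps -> 0 < delta -> 0 <= eta ->
  measurable_fun setT u -> measurable_fun setT v ->
  (\int[mu]_x (`|u x| `^ p)%:E < +oo)%E -> (\int[mu]_x (`|v x| `^ p)%:E < +oo)%E ->
  (forall y, D y -> exists2 z, F z & box z eps y) ->
  (forall z, F z ->
    `|box_integral mu box z eps u - box_integral mu box z eps v| <= eta) ->
  ((om * eps `^ Q)%:E * \int[mu]_(x in D) (`|u x - v x|)%:E <=
   ((eta + 2 * (delta * (om * eps `^ Q))) * W)%:E +
   (delta `^ (1 - p) * (2 * eps) `^ (Q + Q))%:E *
     (energy mu dist Q p u + energy mu dist Q p v))%E.
Proof.
move=> mD muD eps0 delta0 eta0 mu_ mv uoo voo DF Feta.
have Au y z := @box_average _ _ _ mu dist Q om box mb p p_ge1 u z eps delta y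
  eps0 delta0 mu_ uoo.
have Av y z := @box_average _ _ _ mu dist Q om box mb p p_ge1 v z eps delta y
  eps0 delta0 mv voo.
have b0 : 0 <= om * eps `^ Q.
  by rewrite mulr_ge0 ?powR_ge0// ltW// (mb_om_gt0 mb).
have K0 : 0 <= delta `^ (1 - p) * (2 * eps) `^ (Q + Q) by rewrite mulr_ge0 ?powR_ge0.
have meu := measurable_energy_at mb p mu_.
have mev := measurable_energy_at mb p mv.
have eu0 y := energy_at_ge0 mu dist Q p u y.
have ev0 y := energy_at_ge0 mu dist Q p v y.
rewrite /energy; move: (om * eps `^ Q) (_ `^ _ * _ `^ _) b0 K0 Au Av => b K b0 K0.
move: (energy_at mu dist Q p u) (energy_at mu dist Q p v) meu mev eu0 ev0.
move=> eu ev meu mev eu0 ev0 Au Av.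
have muv : measurable_fun D (fun x => (`|u x - v x|)%:E).
  apply/measurable_funTS/measurable_EFinP; apply: measurableT_comp => //.
  exact: measurable_funB.
rewrite -ge0_integralZl ?lee_fin//.
pose c := eta + 2 * (delta * b).
have c0 : 0 <= c by apply: addr_ge0 => //; rewrite mulr_ge0 // mulr_ge0 // ltW.
have meuv : measurable_fun D (fun y => eu y + ev y)%E.
  by apply: measurable_funTS; exact: emeasurable_funD.
apply: (@le_trans _ _ (\int[mu]_(y in D) (c%:E + K%:E * (eu y + ev y)))%E).
  apply: ge0_le_integral => //.
  - by move=> x _; rewrite -EFinM lee_fin mulr_ge0.
  - exact: measurable_funeM.
  - by apply: emeasurable_funD => //; exact: measurable_funeM.
  move=> y Dy; have [z Fz zy] := DF _ Dy.
  have uv := Feta _ Fz; have Hu := Au _ _ zy; have Hv := Av _ _ zy.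
  rewrite -EFinM.
  apply: (@le_trans _ _ (eta%:E +
    ((`|b * u y - box_integral mu box z eps u|)%:E +
     (`|b * v y - box_integral mu box z eps v|)%:E))%E).
    rewrite -!EFinD lee_fin -[X in X * `|_|](ger0_norm b0) -normrM.
    rewrite [X in `|X|](_ : _ = (box_integral mu box z eps u - box_integral mu box z eps v) +
      ((b * u y - box_integral mu box z eps u) -
       (b * v y - box_integral mu box z eps v))); last by ring.
    apply: (le_trans (ler_normD _ _)); apply: lerD => //.
    exact: ler_normB.
  apply: (@le_trans _ _ (eta%:E + (((delta * b)%:E + K%:E * eu y) +
      ((delta * b)%:E + K%:E * ev y)))%E).
    by rewrite leeD2l// leeD.
  rewrite ge0_muleDr//; move: (K%:E * eu y)%E (K%:E * ev y)%E => A B.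
  rewrite [X in (_ + X <= _)%E]addeACA addeA -!EFinD.
  by rewrite (_ : eta + _ = c)// /c; ring.
rewrite ge0_integralD//; last 2 first.
- by move=> x _; rewrite mule_ge0 ?lee_fin// adde_ge0.
- exact: measurable_funeM.
rewrite integral_cst// [X in (_ * X)%E]muD -EFinM leeD2l//.
rewrite ge0_integralZl//; last by move=> x _; exact: adde_ge0.
apply: lee_wpmul2l; first by rewrite lee_fin.
rewrite ge0_integralD//; [|exact: measurable_funTS..].
by apply: leeD; apply: ge0_subset_integral.
Qed.

(* The parameters are chosen in the order delta, eps, eta. *)
Lemma L1_small (D : set T) (W lam eta0 : R) :
  measurable D -> mu D = W%:E -> 0 < lam -> 0 < eta0 ->
  exists2 eps : R, 0 < eps & exists2 eta : R, 0 < eta &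
  forall (F : set T) u v,
  measurable_fun setT u -> measurable_fun setT v ->
  (\int[mu]_x (`|u x| `^ p)%:E < +oo)%E -> (\int[mu]_x (`|v x| `^ p)%:E < +oo)%E ->
  (energy mu dist Q p u <= (lam `^ p)%:E)%E ->
  (energy mu dist Q p v <= (lam `^ p)%:E)%E ->
  (forall y, D y -> exists2 z, F z & box z eps y) ->
  (forall z, F z ->
    `|box_integral mu box z eps u - box_integral mu box z eps v| <= eta) ->
  (\int[mu]_(x in D) (`|u x - v x|)%:E <= eta0%:E)%E.
Proof.
move=> mD muD lam0 eta00.
have om0 := mb_om_gt0 mb; have Q0 := mb_Q_gt0 mb.
have W0 : 0 <= W by rewrite -lee_fin -muD.
(* Makes [2 * delta * W] at most a third of [eta0]; [W + 1] avoids dividing by a zero measure. *)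
pose delta := eta0 / (6 * (W + 1)).
have delta0 : 0 < delta by rewrite divr_gt0// mulr_gt0//; lra.
(* After division by [om * eps ^ Q] the energy term is at most [c * eps ^ Q]; [eps] makes this
   [eta0 / 3]. *)
pose c := delta `^ (1 - p) * 2 `^ (Q + Q) * (2 * lam `^ p) / om.
have c0 : 0 < c by rewrite !mulr_gt0 ?powR_gt0 ?invr_gt0.
pose eps := (eta0 / (3 * c)) `^ Q^-1.
have q0 : 0 < eta0 / (3 * c) by apply: divr_gt0 => //; exact: mulr_gt0.
have eps0 : 0 < eps by exact: powR_gt0.
have epsQ : eps `^ Q = eta0 / (3 * c).
  by rewrite -powRrM mulVf ?gt_eqF// powRr1// ltW.
pose b := om * eps `^ Q.
have b0 : 0 < b by rewrite mulr_gt0// powR_gt0.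
(* The last third: [eta * W / b] is at most [eta0 / 3]. *)
pose eta := b * eta0 / (3 * (W + 1)).
have eta_gt0 : 0 < eta by rewrite divr_gt0 ?mulr_gt0//; lra.
exists eps => //; exists eta => // F u v mu_ mv uoo voo eu ev DF Feta.
have := L1_box_estimate mD muD eps0 delta0 (ltW eta_gt0) mu_ mv uoo voo DF Feta.
rewrite -/b; move: (energy mu dist Q p u) (energy mu dist Q p v) eu ev.
move=> Eu Ev leEu leEv H.
rewrite -(@lee_pmul2l _ b%:E)//; apply: (le_trans H).
apply: (@le_trans _ _ (((eta + 2 * (delta * b)) * W)%:E +
  (delta `^ (1 - p) * (2 * eps) `^ (Q + Q))%:E * ((lam `^ p)%:E + (lam `^ p)%:E))%E).
  apply: leeD2l; apply: lee_wpmul2l; last exact: leeD.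
  by rewrite lee_fin mulr_ge0 ?powR_ge0.
rewrite -!(EFinD, EFinM) lee_fin.
rewrite powRM ?(ltW eps0)// (_ : _ * (_ + _) = b * (eps `^ Q * c)); last first.
  rewrite /b /c [eps `^ (Q + Q)]powRD; last by rewrite (gt_eqF (addr_gt0 Q0 Q0)).
  by field; rewrite gt_eqF.
rewrite epsQ (_ : _ / _ * c = eta0 / 3); last by field; rewrite gt_eqF.
rewrite /eta /delta.
have W1 : W + 1 != 0 by rewrite gt_eqF//; lra.
rewrite (_ : _ * W = b * (2 / 3 * eta0 * (W / (W + 1)))); last by field.
rewrite -mulrDr ler_pM2l//.
have : W / (W + 1) <= 1 by rewrite ler_pdivrMr; lra.
nra.
Qed.

End L1_estimate.

(** * Limits along ultrafilters *)

Lemma filter_all_seq (I : eqType) (T : Type) (U : set_system T) (s : seq I)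
    (P : I -> set T) : Filter U -> (forall z, z \in s -> U (P z)) ->
  U [set i | forall z, z \in s -> P z i].
Proof.
move=> FU; elim: s => [|z s IH] UP.
  by apply: (filterS _ (@filterT _ U _)) => i _ z; rewrite in_nil.
have Us := IH (fun y ys => UP y (mem_behead (s := z :: s) ys)).
apply: filterS2 (UP z (mem_head _ _)) Us => i Pz Ps y.
by rewrite in_cons => /orP[/eqP->//|]; exact: Ps.
Qed.

(** If a larger proper filter contained a set [B] whose preimage is not in [U], the preimage of the
    complement would be in [U], and the filter would contain the empty set. *)
Lemma fmap_ultra (T S : Type) (U : set_system T) (f : T -> S) :
  UltraFilter U -> UltraFilter (fmap f U).
Proof.
move=> UU; split => [|G PG UG]; first exact: fmap_proper_filter.
apply/seteqP; split => // B GB.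
have [//|UnB] := in_ultra_setVsetC (f @^-1` B) UU.
have : G set0 by rewrite -(setICr B); apply: filterI => //; exact: UG.
by move/filter_not_empty.
Qed.

Lemma ultrafilter_bounded_cvg (R : realType) (T : Type) (U : set_system T)
    (f : T -> R) (c : R) : UltraFilter U -> (forall i, `|f i| <= c) ->
  exists l : R, f @ U --> l.
Proof.
move=> UU fc.
have fU : U (f @^-1` `[- c, c]).
  apply: (@filterS _ U _ setT); last exact: filterT.
  by move=> i _ /=; rewrite in_itv/= -ler_norml.
have := @segment_compact R (- c) c; rewrite compact_ultra => cc.
have [|l [_ fl]] := cc (f @ U) _ fU; first exact: fmap_ultra.
by exists l.
Qed.

(** * Extraction of L^1-Cauchy subsequences *)

Section L1_compactness.
Context d {T : measurableType d} {R : realType}.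
Variables (mu : {sigma_finite_measure set T -> \bar R}) (dist : T -> T -> R).
Variables (Q om : R) (box : T -> R -> set T).
Hypothesis mb : metric_boxes mu dist Q om box.
Variable p : R.
Hypothesis p_ge1 : 1 <= p.

(** All box integrals converge along one ultrafilter, whatever the scale and the centre. For each
    [m] it therefore contains a set [A m] of indices with pairwise distances at most [2 ^- m], and
    indices picked from finite intersections of the [A m] need no diagonal argument. *)
Lemma L1_cauchy_subsequence (D : set T) (W lam : R) (u : nat -> T -> R) :
  measurable D -> mu D = W%:E -> 0 < lam ->
  (forall i, measurable_fun setT (u i)) ->
  (forall i, \int[mu]_x (`|u i x| `^ p)%:E <= (lam `^ p)%:E)%E ->
  (forall i, energy mu dist Q p (u i) <= (lam `^ p)%:E)%E ->
  (forall eps, 0 < eps -> exists F : seq T, forall y, D y ->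
    exists2 z, z \in F & box z eps y) ->
  exists2 e : nat -> nat, {homo e : i j / (i < j)%N} &
    forall i j, (i <= j)%N ->
      (\int[mu]_(x in D) (`|u (e i) x - u (e j) x|)%:E <= (2^-1 ^+ i)%:E)%E.
Proof.
move=> mD muD lam0 mu_ up ue tb.
(* An ultrafilter containing all tails, so that indices can be chosen arbitrarily large. *)
have [U [UU ooU]] := ultraFilterLemma (eventually_filter).
have H (eta : R) : 0 < eta -> exists A : set nat, U A /\ forall i j, A i -> A j ->
    (\int[mu]_(x in D) (`|u i x - u j x|)%:E <= eta%:E)%E.
  move=> eta0.
  have [eps eps0 [del del0 Hdel]] := L1_small mb p_ge1 mD muD lam0 eta0.
  have [F DF] := tb _ eps0.
  have lP z : exists l : R, box_integral mu box z eps (u i) @[i --> U] --> l.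
    apply: (@ultrafilter_bounded_cvg _ _ _ _ (om * eps `^ Q + lam `^ p)) => i.
    exact: (box_integral_bounded mb p_ge1).
  pose l z := projT1 (cid (lP z)).
  (* Within [del / 2] of the limits, hence pairwise within [del], at the finitely many centres. *)
  exists [set i | forall z, z \in F ->
    `|l z - box_integral mu box z eps (u i)| < del / 2].
  split.
    apply: filter_all_seq => z _; have /cvgrPdist_lt := projT2 (cid (lP z)).
    by apply; rewrite divr_gt0.
  move=> i j Ai Aj; apply: (Hdel [set` F]) => //.
  - exact: le_lt_trans (up i) (ltry _).
  - exact: le_lt_trans (up j) (ltry _).
  move=> z Fz; have := Ai _ Fz; have := Aj _ Fz => lj li.
  have := ler_distD (l z) (box_integral mu box z eps (u i))
    (box_integral mu box z eps (u j)).
  rewrite (distrC (box_integral mu box z eps (u i)) (l z)); lra.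
have H2 m := H (2^-1 ^+ m) (exprn_gt0 m (ltac:(by rewrite invr_gt0) : 0 < 2^-1 :> R)).
pose A m := projT1 (cid (H2 m)).
have UA m : U (A m) := (projT2 (cid (H2 m))).1.
have UB m : U [set i | forall j, (j <= m)%N -> A j i].
  apply: filterS (@filter_all_seq _ _ U (iota 0 m.+1) A _ (fun z _ => UA z)).
  by move=> i Ai j jm; apply: Ai; rewrite mem_iota.
(* A member of the ultrafilter is nonempty: there is an index beyond [n] common to [A 0], ...,
   [A m]. *)
have gP m n : exists i, (forall j, (j <= m)%N -> A j i) /\ (n < i)%N.
  have Un : U [set i | (n < i)%N] by apply: ooU; exists n.+1.
  by have [i [Ai ni]] := filter_ex (filterI (UB m) Un); exists i.
pose g m n := projT1 (cid (gP m n)).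
have gA m n j : (j <= m)%N -> A j (g m n) by exact: (projT2 (cid (gP m n))).1.
have gn m n : (n < g m n)%N by exact: (projT2 (cid (gP m n))).2.
pose e := fix e m := if m is m'.+1 then g m (e m') else g 0%N 0%N.
have eA i j : (i <= j)%N -> A i (e j) by case: j => [|j] ij; exact: gA.
have eS m : (e m < e m.+1)%N by exact: gn.
exists e.
  apply: (@homo_ltn _ e (fun i j => (i < j)%N)) => // y x z.
  exact: ltn_trans.
by move=> i j ij; apply: (projT2 (cid (H2 i))).2; exact: eA.
Qed.

End L1_compactness.

(** * Passage to the limit in L^r *)

Lemma cvg_powRl (R : realType) (a : nat -> R) (l r : R) : 0 < r ->
  (forall n, 0 <= a n) -> a n @[n --> \oo] --> l ->
  a n `^ r @[n --> \oo] --> l `^ r.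
Proof.
move=> r0 a0 al.
have l0 : 0 <= l.
  rewrite -(cvg_lim (@Rhausdorff R) al); apply: limr_ge; last exact: nearW.
  by apply/cvg_ex; exists l.
have [l_eq0|l_neq0] := eqVneq l 0.
  rewrite l_eq0 powR0 ?gt_eqF// in al *.
  apply/cvgrPdist_lt => e e0; near=> n.
  rewrite sub0r normrN ger0_norm ?powR_ge0//.
  rewrite -[ltRHS](@powRr1 _ e) ?(ltW e0)// -(mulVf (lt0r_neq0 r0)) powRrM.
  rewrite gt0_ltr_powR ?nnegrE ?powR_ge0//.
  near: n; have /cvgr_lt := al; apply; exact: powR_gt0.
have {l_neq0}l0 : 0 < l by rewrite lt_neqAle eq_sym l_neq0.
have c : expR (r * ln (a n)) @[n --> \oo] --> expR (r * ln l).
  apply: (cvg_comp (fun n => r * ln (a n)) expR); last exact: continuous_expR.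
  have cl : {for l, continuous (@ln R)} by exact: continuous_ln.
  by apply: cvgMr; exact: (cvg_comp _ _ al cl).
have -> : l `^ r = expR (r * ln l) by rewrite /powR gt_eqF.
suff E : {near \oo, (fun n => expR (r * ln (a n))) =1 (fun n => a n `^ r)}.
  exact: cvg_trans (near_eq_cvg E) c.
near=> n; rewrite /powR gt_eqF//; near: n; have /cvgr_gt := al; exact.
Unshelve. all: by end_near. Qed.

(** The telescoping series of [h] converges absolutely. *)
Lemma cvg_of_abs_increments (R : realType) (h : nat -> R) (c : R) :
  (forall n, \sum_(0 <= k < n) `|h k - h k.+1| <= c) ->
  exists l : R, h n @[n --> \oo] --> l.
Proof.
move=> hc.
have cn : cvgn [normed series (telescope h)].
  apply: nondecreasing_is_cvgn.
    by apply/nondecreasing_seqP => n; rewrite /normed_series_of seriesSr lerDl; exact: normr_ge0.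
  exists c => _ [n _ <-]; apply: le_trans (hc n).
  by rewrite le_eqVlt; apply/orP; left; apply/eqP; apply: eq_bigr => k _; rewrite distrC.
have /cvg_ex[l] := normed_cvg cn; rewrite telescopeK => hl.
exists (l + h 0%N).
have h0 : (fun=> h 0%N) @ \oo --> h 0%N by exact: cvg_cst.
apply: cvg_trans (cvgD hl h0); apply: near_eq_cvg; apply: nearW => n /=.
by rewrite [LHS]subrK.
Qed.

Lemma powR_addle (R : realType) (a b s : R) : 0 <= a -> 0 <= b -> 0 <= s ->
  (a + b) `^ s <= 2 `^ s * (a `^ s + b `^ s).
Proof.
move=> a0 b0 s0.
wlog ab : a b a0 b0 / a <= b => [H|].
  by have [/H->//|/ltW/H] := leP a b; rewrite addrC [_ `^ s + _]addrC; exact.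
apply: (@le_trans _ _ ((2 * b) `^ s)).
  by rewrite ge0_ler_powR ?nnegrE ?addr_ge0 ?mulr_ge0//; lra.
by rewrite powRM// ler_wpM2l ?powR_ge0// lerDr powR_ge0.
Qed.

Section Lr_limit.
Context d {T : measurableType d} {R : realType}.
Variable mu : {measure set T -> \bar R}.

(** The sum of the absolute increments has integral at most 2 over [D], hence is finite almost
    everywhere there. *)
Lemma cvg_ae_of_L1_increments (D : set T) (h : nat -> T -> R) :
  measurable D -> (forall i, measurable_fun setT (h i)) ->
  (forall i, \int[mu]_(x in D) (`|h i x - h i.+1 x|)%:E <= (2^-1 ^+ i)%:E)%E ->
  {ae mu, forall x, D x -> exists l : R, h n x @[n --> \oo] --> l}.
Proof.
move=> mD mh hD.
pose f k x := (`|h k x - h k.+1 x|)%:E.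
have mf k : measurable_fun setT (f k).
  apply/measurable_EFinP; apply: measurableT_comp => //.
  exact: measurable_funB.
have f0 k x : (0 <= f k x)%E by rewrite lee_fin.
have mS : measurable_fun setT (fun x => \sum_(k <oo) f k x)%E.
  by apply: (@ge0_emeasurable_sum _ _ _ _ f xpredT).
have S0 x : (0 <= \sum_(k <oo) f k x)%E by exact: nneseries_ge0.
have iS : mu.-integrable D (fun x => \sum_(k <oo) f k x)%E.
  apply/integrableP; split; first exact: measurable_funTS.
  under eq_integral => x _ do rewrite (gee0_abs (S0 x)).
  rewrite integral_nneseries//; last by move=> k; exact: measurable_funTS.
  apply: (@le_lt_trans _ _ 2%:E); last exact: ltry.
  apply: nneseries_le => [k|n]; first exact: integral_ge0.
  apply: (@le_trans _ _ (\sum_(0 <= k < n) (2^-1 ^+ k)%:E)%E).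
    by apply: lee_sum => k _; exact: hD.
  rewrite sumEFin lee_fin.
  have -> : \sum_(0 <= k < n) 2^-1 ^+ k = 2 - 2 * 2^-1 ^+ n :> R.
    elim: n => [|n IH]; first by rewrite big_nil expr0 mulr1 subrr.
    by rewrite big_nat_recr//= IH exprS; field.
  by rewrite gerBl mulr_ge0// exprn_ge0// invr_ge0.
apply: filterS (integrable_ae mD iS) => x Sfin Dx.
apply: (@cvg_of_abs_increments _ _ (fine (\sum_(k <oo) f k x)%E)) => n.
rewrite -lee_fin fineK; last exact: Sfin.
rewrite -sumEFin; exact: nneseries_lim_ge.
Qed.

Lemma Lr_limit (D : set T) (h : nat -> T -> R) (r : R) : 0 < r ->
  measurable D -> (forall i, measurable_fun setT (h i)) ->
  (forall i, \int[mu]_(x in D) (`|h i x - h i.+1 x|)%:E <= (2^-1 ^+ i)%:E)%E ->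
  exists2 v : T -> R, measurable_fun setT v &
  forall i (c : R), (forall j, (i <= j)%N ->
      (\int[mu]_(x in D) (`|h i x - h j x| `^ r)%:E <= c%:E)%E) ->
    (\int[mu]_(x in D) (`|h i x - v x| `^ r)%:E <= c%:E)%E.
Proof.
move=> r0 mD mh hD.
(* v is the a.e. limit of the h j; conclude by Fatou's lemma along j. *)
pose v x := fine (limn_esup (fun n => (h n x)%:E)).
have mv : measurable_fun setT v.
  apply: measurableT_comp => //.
  by apply: measurable_fun_limn_esup => n; exact/measurable_EFinP.
exists v => // i c hc.
pose f n x := (`|h i x - h n x| `^ r)%:E.
have mf n : measurable_fun setT (f n).
  apply/measurable_EFinP; apply: (measurableT_comp (measurable_powR _)).
  by apply: measurableT_comp => //; exact: measurable_funB.
have f0 n x : (0 <= f n x)%E by rewrite lee_fin powR_ge0.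
apply: (@le_trans _ _ (\int[mu]_(x in D) limn_einf (f^~ x))%E).
  apply: ae_ge0_le_integral => //.
  - apply/measurable_funTS/measurable_EFinP.
    apply: (measurableT_comp (measurable_powR _)).
    by apply: measurableT_comp => //; exact: measurable_funB.
  - move=> x _; rewrite limn_einf_lim; apply: lime_ge; first exact: is_cvg_einfs.
    by apply: nearW => m; apply: le_ereal_inf_tmp => _ [n _ <-].
  - apply: measurableT_comp => //; apply: measurable_fun_limn_esup => n.
    by apply: measurableT_comp => //; exact: measurable_funTS.
  apply: filterS (cvg_ae_of_L1_increments mD mh hD) => x hx Dx.
  have [l hl] := hx Dx.
  have -> : v x = l.
    rewrite /v; have /cvg_limn_einf_sup[_ ->//] : (h n x)%:E @[n --> \oo] --> l%:E.
    by apply/fine_cvgP; split => //; exact: nearW.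
  have /cvg_limn_einf_sup[-> _] // : f n x @[n --> \oo] --> (`|h i x - l| `^ r)%:E.
  apply/fine_cvgP; split; first exact: nearW.
  have hi : (fun=> h i x) @ \oo --> h i x by exact: cvg_cst.
  by apply: cvg_powRl => //; apply: cvg_norm; exact: (cvgB hi hl).
apply: (le_trans (fatou _ _ _ _)) => //; first by move=> n; exact: measurable_funTS.
rewrite limn_einf_lim; apply: lime_le; first exact: is_cvg_einfs.
(* The index [maxn m i] lies in the tail over which the infimum is taken and is at least [i], as
   [hc] requires. *)
apply: nearW => m; apply: (@le_trans _ _ (\int[mu]_(x in D) f (maxn m i) x)%E).
  by apply: ereal_inf_lbound; exists (maxn m i) => //=; exact: leq_maxl.
exact/hc/leq_maxr.
Qed.

End Lr_limit.

(** * Compactness in L^r *)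

Section Lr_compactness.
Context d {T : measurableType d} {R : realType}.
Variables (mu : {sigma_finite_measure set T -> \bar R}) (dist : T -> T -> R).
Variables (Q om : R) (box : T -> R -> set T).
Hypothesis mb : metric_boxes mu dist Q om box.
Variable p : R.
Hypothesis p_ge1 : 1 <= p.

Lemma integral_powR_sub (D : set T) (f g : T -> R) (s : R) (a b : \bar R) :
  measurable D -> 0 <= s -> measurable_fun setT f -> measurable_fun setT g ->
  (\int[mu]_(x in D) (`|f x| `^ s)%:E <= a)%E ->
  (\int[mu]_(x in D) (`|g x| `^ s)%:E <= b)%E ->
  (\int[mu]_(x in D) (`|f x - g x| `^ s)%:E <= (2 `^ s)%:E * (a + b))%E.
Proof.
move=> mD s0 mf mg fa gb.
have mfs := measurable_funTS (D := D) (measurable_powR_norm s mf).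
have mgs := measurable_funTS (D := D) (measurable_powR_norm s mg).
have ms : measurable_fun D (fun x => (`|f x - g x| `^ s)%:E).
  apply: measurable_funTS; apply: (measurable_powR_norm s (u := fun x => f x - g x)).
  exact: measurable_funB.
apply: (@le_trans _ _ (\int[mu]_(x in D)
    ((2 `^ s)%:E * ((`|f x| `^ s)%:E + (`|g x| `^ s)%:E)))%E).
  apply: ge0_le_integral => //.
  - by apply: measurable_funeM; exact: emeasurable_funD.
  move=> x _; rewrite -EFinD -EFinM lee_fin.
  apply: le_trans (powR_addle _ _ _) => //.
  by rewrite ge0_ler_powR ?nnegrE ?addr_ge0// ler_normB.
rewrite ge0_integralZl//; last first.
- by move=> x _; rewrite -EFinD lee_fin addr_ge0 ?powR_ge0.
- exact: emeasurable_funD.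
apply: lee_wpmul2l; first by rewrite lee_fin powR_ge0.
by rewrite ge0_integralD// leeD.
Qed.

(** Interpolation between the exponents 1 and [r + p]. The second term carries [t ^ (- p)], so a
    large [t] makes it small, and then a small L^1 norm makes the first one small. *)
Lemma integral_powR_interpolation (D : set T) (f : T -> R) (t r c c' : R) :
  measurable D -> 0 < t -> 1 <= r -> measurable_fun setT f ->
  (\int[mu]_(x in D) (`|f x|)%:E <= c%:E)%E ->
  (\int[mu]_(x in D) (`|f x| `^ (r + p))%:E <= c'%:E)%E ->
  (\int[mu]_(x in D) (`|f x| `^ r)%:E <=
    (t `^ (r - 1) * c + t `^ (- p) * c')%:E)%E.
Proof.
move=> mD t0 r1 mf fc fc'.
have mfr s := measurable_funTS (D := D) (measurable_powR_norm s mf).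
have mf1 : measurable_fun D (fun x => (`|f x|)%:E).
  by apply/measurable_funTS/measurable_EFinP; exact: measurableT_comp.
apply: (@le_trans _ _ (\int[mu]_(x in D) ((t `^ (r - 1))%:E * (`|f x|)%:E +
    (t `^ (- p))%:E * (`|f x| `^ (r + p))%:E))%E).
  apply: ge0_le_integral => //.
  - by apply: emeasurable_funD; exact: measurable_funeM.
  move=> x _; rewrite -!EFinM -EFinD lee_fin.
  have rp : r <= r + p by rewrite lerDl (le_trans ler01).
  have := powR_interpolation (normr_ge0 (f x)) t0 (lt_le_trans ltr01 r1) r1 rp.
  by rewrite powRr1// (_ : r - (r + p) = - p)//; ring.
rewrite ge0_integralD//; last 4 first.
- by move=> x _; rewrite -EFinM lee_fin mulr_ge0 ?powR_ge0.
- exact: measurable_funeM.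
- by move=> x _; rewrite -EFinM lee_fin mulr_ge0 ?powR_ge0.
- exact: measurable_funeM.
rewrite !ge0_integralZl//; last 2 first.
- by rewrite lee_fin powR_ge0.
- by rewrite lee_fin powR_ge0.
by rewrite EFinD !EFinM leeD// lee_wpmul2l// lee_fin powR_ge0.
Qed.

Lemma Lr_compactness (D : set T) (W lam r : R) (u : nat -> T -> R) :
  1 <= r -> measurable D -> mu D = W%:E -> 0 < lam ->
  (forall i, measurable_fun setT (u i)) ->
  (forall i, \int[mu]_x (`|u i x| `^ p)%:E <= (lam `^ p)%:E)%E ->
  (forall i, energy mu dist Q p (u i) <= (lam `^ p)%:E)%E ->
  (forall eps, 0 < eps -> exists F : seq T, forall y, D y ->
    exists2 z, z \in F & box z eps y) ->
  exists (e : nat -> nat) (v : T -> R),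
    [/\ {homo e : i j / (i < j)%N}, measurable_fun setT v &
      forall eta : R, 0 < eta -> exists n, forall i, (n <= i)%N ->
      (\int[mu]_(x in D) (`|u (e i) x - v x| `^ r)%:E <= eta%:E)%E].
Proof.
move=> r1 mD muD lam0 mu_ up ue tb.
have [e e_homo eL1] := L1_cauchy_subsequence mb p_ge1 mD muD lam0 mu_ up ue tb.
have r0 : 0 < r by exact: lt_le_trans r1.
have [v mv Hv] := Lr_limit r0 mD (fun i => mu_ (e i))
  (fun i => eL1 _ _ (leqnSn i)).
exists e, v; split => // eta eta0.
(* The exponent [r + p] is at least [p], so [critical_bound] covers it, and exceeds [r], leaving
   room to interpolate. *)
have prp : p <= r + p by lra.
have [C C0 HC] := critical_bound mb p_ge1 prp.
pose B := C * lam `^ (r + p).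
have uB i : (\int[mu]_(x in D) (`|u i x| `^ (r + p))%:E <= B%:E)%E.
  apply: le_trans (HC _ _ (mu_ i) lam0 (up i) (ue i)).
  apply: ge0_subset_integral => //.
  exact: measurable_powR_norm.
pose B' := 2 `^ (r + p) * (B + B).
have B0 : 0 < B' by rewrite !mulr_gt0 ?addr_gt0 ?mulr_gt0 ?powR_gt0.
(* Chosen so that the high-exponent term is exactly [eta / 2]; then [n] brings the L^1 term below
   [eta / 2]. *)
pose t := (2 * B' / eta) `^ p^-1.
have p0 : 0 < p by exact: lt_le_trans p_ge1.
have q0 : 0 < 2 * B' / eta by rewrite divr_gt0// mulr_gt0.
have t0 : 0 < t by rewrite powR_gt0.
have tp : t `^ (- p) * B' = eta / 2.
  rewrite powRN -powRrM mulVf ?gt_eqF// powRr1 ?(ltW q0)//.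
  by field; rewrite !gt_eqF.
have [n Hn] : exists n, t `^ (r - 1) * 2^-1 ^+ n <= eta / 2.
  have [m Hm] : exists m, t `^ (r - 1) * 2 / eta <= 2 ^+ m.
    exists (Num.truncn (t `^ (r - 1) * 2 / eta)).+1.
    apply: (@le_trans _ _ (Num.truncn (t `^ (r - 1) * 2 / eta)).+1%:R).
      exact/ltW/truncnS_gt.
    by rewrite -natrX ler_nat ltnW// ltn_expl.
  exists m; rewrite exprVn; have m0 : 0 < 2 ^+ m :> R by exact: exprn_gt0.
  move: (t `^ (r - 1)) (2 ^+ m) m0 Hm => x y y0; rewrite !ler_pdivrMr// => ?; lra.
exists n => i ni; apply: Hv => j ij.
apply: (@le_trans _ _ (t `^ (r - 1) * 2^-1 ^+ i + t `^ (- p) * B')%:E).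
  apply: integral_powR_interpolation => //; first exact: measurable_funB.
    exact: eL1.
  rewrite /B' EFinM EFinD; apply: integral_powR_sub => //; lra.
rewrite lee_fin tp; suff : t `^ (r - 1) * 2^-1 ^+ i <= eta / 2 by lra.
apply: le_trans Hn; apply: ler_wpM2l; first exact: powR_ge0.
by rewrite ler_wiXn2l// invf_le1// ler1n.
Qed.

End Lr_compactness.

(** * Application to stratified groups *)

(** The powers [r] and [r^-1] are increasing inverse bijections of [[0, +oo]]; bounds on norms are
    exchanged for bounds on integrals in this way. *)
Lemma poweR_inv_le (R : realType) (A : \bar R) (r lam : R) :
  0 < r -> 0 <= lam -> (0 <= A)%E ->
  (A `^ r^-1 <= lam%:E)%E = (A <= (lam `^ r)%:E)%E.
Proof.
move=> r0 lam0 A0; apply/idP/idP => H.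
  have -> : A = ((A `^ r^-1) `^ r)%E.
    by rewrite -poweRrM mulVf ?gt_eqF// poweRe1.
  rewrite -poweR_EFin; apply: gt0_ler_poweR => //; first exact: ltW.
  - by rewrite in_itv/= poweR_ge0 leey.
  - by rewrite in_itv/= lee_fin lam0 leey.
have -> : lam%:E = ((lam `^ r)%:E `^ r^-1)%E.
  by rewrite poweR_EFin -powRrM divff ?gt_eqF// powRr1.
apply: gt0_ler_poweR => //; first by rewrite invr_ge0 ltW.
- by rewrite in_itv/= A0 leey.
- by rewrite in_itv/= lee_fin powR_ge0 leey.
Qed.

(** * Norms, integrals and bounded sets *)

Section Lp_norm_integral.
Context {R : realType} {m : nat}.
Implicit Types (U : set 'rV[R]_m) (u v : 'rV[R]_m -> R).

Lemma Lp_norm_le (r lam : R) U u : 0 < r -> 0 <= lam -> measurable U ->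
  (Lp_norm r U u <= lam%:E)%E =
  (\int[lebesgue_rV m]_(x in U) (`|u x| `^ r)%:E <= (lam `^ r)%:E)%E.
Proof.
move=> r0 lam0 mU; rewrite -poweR_inv_le//; last first.
  by apply: integral_ge0 => x _; rewrite lee_fin powR_ge0.
have -> : (\int[lebesgue_rV m]_(x in U) (`|u x| `^ r)%:E =
    \int[lebesgue_rV m]_x `|(EFin \o (u \_ U)) x| `^ r)%E.
  rewrite integral_mkcond; apply: eq_integral => x _ /=.
  rewrite !patchE; case: ifPn => // _.
  by rewrite normr0 powR0// gt_eqF.
by rewrite /Lp_norm unlock.
Qed.

Lemma integral_ae_eq0 (f : 'rV[R]_m -> \bar R) U : measurable U ->
  measurable_fun setT f -> (forall x, 0 <= f x)%E ->
  {ae lebesgue_rV m, forall x, ~ U x -> f x = 0%E} ->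
  (\int[lebesgue_rV m]_x f x = \int[lebesgue_rV m]_(x in U) f x)%E.
Proof.
move=> mU mf f0 aef; rewrite [RHS]integral_mkcond.
apply: ge0_ae_eq_integral => //.
- by apply/(measurable_restrictT f mU)/measurable_funTS.
- by move=> x _; rewrite patchE; case: ifPn.
apply: filterS aef => x fx _; rewrite patchE; case: ifPn => //.
by rewrite notin_setE => /fx.
Qed.

Lemma bounded_set_rV_box U : bounded_set U ->
  exists2 a : R, 0 < a & forall x, U x -> forall j, `|x 0 j| < a.
Proof.
(* Boundedness provides a bound by any number above [M], such as [|M| + 1]; one more unit makes the
   inequality strict. *)
move=> [M [_ HM]]; exists (`|M| + 2); first by rewrite ltr_wpDl.
have {}HM : forall x, U x -> `|x| <= `|M| + 1.
  by apply: HM; rewrite (le_lt_trans (ler_norm M))// ltrDl.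
move=> x Ux j; apply: (@le_lt_trans _ _ `|x|).
  rewrite [leRHS]/Num.norm/= mx_normrE; apply/bigmax_geP; right.
  by exists (0, j).
by rewrite (le_lt_trans (HM _ Ux))// ltrD2l; lra.
Qed.

(** A cube containing [U] has finite measure by [lebesgue_rV_triangular] for the identity map. *)
Lemma lebesgue_rV_bounded U : measurable U -> bounded_set U ->
  exists W : R, lebesgue_rV m U = W%:E.
Proof.
move=> mU /bounded_set_rV_box[a a0 Ua].
have mid : measurable_fun setT (@id 'rV[R]_m) by [].
have tid : triangular (@id 'rV[R]_m) by move=> j x y _; rewrite !subrr.
have mB : measurable [set x : 'rV[R]_m | forall j, `|x 0 j| < a].
  by apply: open_measurable_mx; exact: (@open_rV_box _ _ (fun=> a)).
exists (fine (lebesgue_rV m U)); rewrite fineK// ge0_fin_numE//.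
apply: (@le_lt_trans _ _ (lebesgue_rV m [set x | forall j, `|x 0 j| < a])).
  by apply: le_measure; rewrite ?inE.
have := lebesgue_rV_triangular mid tid (fun=> a0).
by move=> ->; rewrite ltry.
Qed.

End Lp_norm_integral.

(** * Stratified groups as metric measure spaces with boxes *)

Section sobolev_boxes.
Context {R : realType} {k : nat} {n : 'I_k -> nat}.
Variables (G : stratified_group R n) (N : 'rV[R]_(\sum_i n i) -> R).
Hypothesis hN : homogeneous_norm G N.
Local Notation V := 'rV[R]_(\sum_i n i).
Local Notation Q := ((homogeneous_dim n)%:R : R).

Lemma sg_metric_boxes : 0 < Q -> exists2 d : R, 0 < d &
  metric_boxes (lebesgue_rV (\sum_i n i)) (sg_dist G N) Q
    ((2 * d) ^+ (\sum_i n i)) (sg_box G d).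
Proof.
move=> Q0; have [d d0 dN] := sg_box_dist hN; exists d => //; split => //.
- by rewrite exprn_gt0// mulr_gt0.
- exact: sg_dist_ge0.
- exact: sg_dist_eq0.
- exact: sg_dist_sym.
- exact: sg_dist_triangle.
- exact: measurable_sg_dist.
- by move=> z rho _; exact: measurable_sg_box.
- by move=> z rho rho0; rewrite lebesgue_sg_box// powR_mulrn// ltW.
Qed.

(** [U] lies in a closed cube, which is compact and covered by the open boxes centred at its
    points. *)
Lemma totally_bounded_sg_box (U : set V) (d eps : R) : 0 < d -> 0 < eps ->
  bounded_set U -> exists F : seq V, forall y, U y ->
    exists2 z, z \in F & sg_box G d z eps y.
Proof.
move=> d0 eps0 bU.
have [a a0 Ua] := bounded_set_rV_box bU.
have cU : compact [set x : V | forall j, `[- a, a]%classic (x ord0 j)].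
  by apply: (@rV_compact _ _ (fun=> `[- a, a]%classic)) => _; exact: segment_compact.
rewrite compact_cover in cU.
have oB z : setT z -> open (sg_box G d z eps) by move=> _; exact: open_sg_box.
have [|F _ UF] := cU V setT (fun z => sg_box G d z eps) oB.
  by move=> y _; exists y => //; exact: sg_box_center.
exists (finmap.enum_fset F) => y Uy; have [|z zF zy] := UF y; last by exists z.
move=> j; rewrite /= in_itv/= -ler_norml; exact/ltW/Ua.
Qed.

End sobolev_boxes.

(** * Embeddings of the fractional Sobolev space *)

Section X0_embeddings.
Context {R : realType} {k : nat} {n : 'I_k -> nat}.
Variables (G : stratified_group R n) (N : 'rV[R]_(\sum_i n i) -> R).
Hypothesis hN : homogeneous_norm G N.
Local Notation V := 'rV[R]_(\sum_i n i).
Local Notation Q := ((homogeneous_dim n)%:R : R).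
Local Notation mu := (@lebesgue_rV R (\sum_i n i)).
Variables (Omega : set V) (s p : R).
Hypothesis (oOmega : open Omega).
Hypothesis s_gt0 : 0 < s.
Hypothesis p_ge1 : 1 <= p.
Hypothesis Q_eq : Q = p * s.

Let p_gt0 : 0 < p. Proof. exact: lt_le_trans p_ge1. Qed.

Let Q_gt0 : 0 < Q. Proof. by rewrite Q_eq mulr_gt0. Qed.

Let mOmega : measurable Omega. Proof. exact: open_measurable_mx. Qed.

(** Both summands of the norm are at most [lam]. Vanishing almost everywhere outside [Omega] extends
    the first integral to the whole space, and [Q_eq] identifies the seminorm with the energy. *)
Lemma X0_norm_bounds (u : V -> R) (lam : R) : 0 <= lam ->
  X0_space G N s p Omega u -> (X0_norm G N s p Omega u <= lam%:E)%E ->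
  [/\ measurable_fun setT u,
      (\int[mu]_x (`|u x| `^ p)%:E <= (lam `^ p)%:E)%E &
      (energy mu (sg_dist G N) Q p u <= (lam `^ p)%:E)%E].
Proof.
move=> lam0 [[[mu_ _] _] u0 _] ulam; split => //.
  rewrite (integral_ae_eq0 mOmega).
  - rewrite -Lp_norm_le//; apply: le_trans ulam.
    by rewrite /X0_norm leeDl// poweR_ge0.
  - exact: measurable_powR_norm.
  - by move=> x; rewrite lee_fin powR_ge0.
  - apply: filterS u0 => x ux /ux ->.
    by rewrite normr0 powR0// gt_eqF.
rewrite -poweR_inv_le//; last first.
  by apply: integral_ge0 => y _; exact: energy_at_ge0.
apply: le_trans ulam; rewrite /X0_norm /gagliardo -Q_eq.
by rewrite leeDr// Lnorm_ge0.
Qed.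

Lemma X0_norm_fin (u : V -> R) : X0_space G N s p Omega u ->
  exists2 m : R, 0 <= m & X0_norm G N s p Omega u = m%:E.
Proof.
move=> [[[mu_ up] ug] u0 _].
have N0 : (0 <= X0_norm G N s p Omega u)%E.
  by rewrite adde_ge0 ?poweR_ge0// Lnorm_ge0.
suff Nfin : X0_norm G N s p Omega u \is a fin_num.
  by exists (fine (X0_norm G N s p Omega u)); rewrite ?fineK// fine_ge0.
rewrite ge0_fin_numE// lte_add_pinfty//.
have upfin : Lp_norm p setT u \is a fin_num by rewrite ge0_fin_numE// Lnorm_ge0.
apply: le_lt_trans up; rewrite -(fineK upfin) Lp_norm_le//; last first.
  by rewrite fine_ge0// Lnorm_ge0.
have : (Lp_norm p setT u <= (fine (Lp_norm p setT u))%:E)%E by rewrite fineK.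
rewrite Lp_norm_le ?fine_ge0 ?Lnorm_ge0//; apply: le_trans.
apply: ge0_subset_integral => //; exact: measurable_powR_norm.
Qed.

(** Reduces the embedding to integral bounds at a positive level [lam] above the norm; the embedding
    constant is [C ^ (1 / r)]. *)
Lemma X0_continuously_embedded (r C : R) : 0 < r -> 0 < C ->
  (forall (u : V -> R) (lam : R), measurable_fun setT u -> 0 < lam ->
    (\int[mu]_x (`|u x| `^ p)%:E <= (lam `^ p)%:E)%E ->
    (energy mu (sg_dist G N) Q p u <= (lam `^ p)%:E)%E ->
    (\int[mu]_(x in Omega) (`|u x| `^ r)%:E <= (C * lam `^ r)%:E)%E) ->
  continuously_embedded (X0_space G N s p Omega) (X0_norm G N s p Omega)
    (Lp_space r Omega) (Lp_norm r Omega).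
Proof.
move=> r0 C0 HC.
have c0 : 0 < C `^ r^-1 by exact: powR_gt0.
have H u lam : X0_space G N s p Omega u -> 0 < lam ->
    (X0_norm G N s p Omega u <= lam%:E)%E ->
    (Lp_norm r Omega u <= (C `^ r^-1 * lam)%:E)%E.
  move=> Xu lam0 ulam; have [mu_ up ue] := X0_norm_bounds (ltW lam0) Xu ulam.
  rewrite Lp_norm_le//; last by rewrite mulr_ge0// ltW.
  rewrite powRM ?(ltW c0) ?(ltW lam0)// -powRrM mulVf ?gt_eqF// powRr1 ?(ltW C0)//.
  exact: HC.
have HX u : X0_space G N s p Omega u ->
    (Lp_norm r Omega u <= (C `^ r^-1)%:E * X0_norm G N s p Omega u)%E.
  move=> Xu; have [m m0 mE] := X0_norm_fin Xu; rewrite mE -EFinM.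
  (* The norm [m] may be 0 while [lam] must be positive, so [m] is enlarged by [e / C ^ (1 / r)]
     with [e] arbitrary. *)
  apply/lee_addgt0Pr => e e0; rewrite -EFinD.
  have -> : C `^ r^-1 * m + e = C `^ r^-1 * (m + e / C `^ r^-1).
    by field; rewrite gt_eqF.
  have me : 0 < e / C `^ r^-1 by rewrite divr_gt0.
  apply: H => //; first by rewrite ltr_wpDl.
  by rewrite mE lee_fin lerDl ltW.
split; last by exists (C `^ r^-1).
move=> u Xu; split.
  by case: (Xu) => -[[mu_ _] _] _ _; exact: measurable_funTS.
have [m m0 mE] := X0_norm_fin Xu.
by apply: le_lt_trans (HX u Xu) _; rewrite mE -EFinM ltry.
Qed.

Lemma X0_continuously_embedded_ge (r : R) : p <= r ->
  continuously_embedded (X0_space G N s p Omega) (X0_norm G N s p Omega)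
    (Lp_space r Omega) (Lp_norm r Omega).
Proof.
move=> pr; have [d d0 mb] := sg_metric_boxes hN Q_gt0.
have [C C0 HC] := critical_bound mb p_ge1 pr.
apply: (X0_continuously_embedded (lt_le_trans p_gt0 pr) C0) => u lam mu_ lam0 up ue.
apply: le_trans (HC u lam mu_ lam0 up ue).
apply: ge0_subset_integral => //; exact: measurable_powR_norm.
Qed.

(** Since [|u|^r <= lam^r + lam^(r-p) |u|^p] and [Omega] has finite measure [W], integration gives
    the constant [W + 1]. *)
Lemma X0_continuously_embedded_le (r : R) : bounded_set Omega -> 0 < r -> r <= p ->
  continuously_embedded (X0_space G N s p Omega) (X0_norm G N s p Omega)
    (Lp_space r Omega) (Lp_norm r Omega).
Proof.
move=> bO r0 rp; have [W muO] := lebesgue_rV_bounded mOmega bO.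
have W0 : 0 <= W by rewrite -lee_fin -muO.
have W1 : 0 < W + 1 by rewrite ltr_wpDl.
apply: (X0_continuously_embedded r0 W1) => u lam mu_ lam0 up _.
have mfs t := measurable_funTS (D := Omega) (measurable_powR_norm t mu_).
apply: (@le_trans _ _ (\int[mu]_(x in Omega) ((lam `^ r)%:E +
    (lam `^ (r - p))%:E * (`|u x| `^ p)%:E))%E).
  apply: ge0_le_integral => //.
  - by apply: emeasurable_funD => //; exact: measurable_funeM.
  move=> x _; rewrite -EFinM -EFinD lee_fin.
  have := powR_interpolation (normr_ge0 (u x)) lam0 r0 (ltW r0) rp.
  by rewrite subr0 powRr0 mulr1.
rewrite ge0_integralD//; last 3 first.
- by move=> x _; rewrite lee_fin powR_ge0.
- by move=> x _; rewrite -EFinM lee_fin mulr_ge0 ?powR_ge0.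
- exact: measurable_funeM.
rewrite integral_cst// [X in (_ * X + _)%E]muO -EFinM ge0_integralZl//; last first.
  by rewrite lee_fin powR_ge0.
rewrite mulrDl mul1r EFinD [W * _]mulrC leeD2l//.
apply: (@le_trans _ _ ((lam `^ (r - p))%:E * (lam `^ p)%:E)%E).
  apply: lee_wpmul2l; first by rewrite lee_fin powR_ge0.
  apply: le_trans up; apply: ge0_subset_integral => //.
  exact: measurable_powR_norm.
by rewrite -EFinM -powRD ?subrK// (gt_eqF lam0) implybT.
Qed.

Lemma X0_compactly_embedded (r : R) : bounded_set Omega -> 1 <= r ->
  compactly_embedded (X0_space G N s p Omega) (X0_norm G N s p Omega)
    (Lp_space r Omega) (Lp_norm r Omega).
Proof.
move=> bO r1; have r0 : 0 < r by exact: lt_le_trans r1.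
have cemb : continuously_embedded (X0_space G N s p Omega) (X0_norm G N s p Omega)
    (Lp_space r Omega) (Lp_norm r Omega).
  have [rp|/ltW pr] := leP r p; first exact: X0_continuously_embedded_le.
  exact: X0_continuously_embedded_ge.
split => // u M Xu uM.
have [W muO] := lebesgue_rV_bounded mOmega bO.
have [d d0 mb] := sg_metric_boxes hN Q_gt0.
(* A positive bound on the norms, whatever the sign of [M]. *)
pose lam : R := `|M| + 1; have lam0 : 0 < lam by rewrite ltr_wpDl.
have ulam i : (X0_norm G N s p Omega (u i) <= lam%:E)%E.
  by apply: le_trans (uM i) _; rewrite lee_fin (le_trans (ler_norm M))// lerDl.
have uB i := X0_norm_bounds (ltW lam0) (Xu i) (ulam i).
have mu_ i : measurable_fun setT (u i) by case: (uB i).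
have up i : (\int[mu]_x (`|u i x| `^ p)%:E <= (lam `^ p)%:E)%E by case: (uB i).
have ue i : (energy mu (sg_dist G N) Q p (u i) <= (lam `^ p)%:E)%E by case: (uB i).
have [e [v [e_homo mv Hv]]] := Lr_compactness mb p_ge1 r1 mOmega muO lam0 mu_ up ue
  (fun eps eps0 => totally_bounded_sg_box G d0 eps0 bO).
have Lp0 f : (0 <= Lp_norm r Omega f)%E by exact: Lnorm_ge0.
have Hnorm (eps : R) : 0 < eps -> exists m, forall i, (m <= i)%N ->
    (Lp_norm r Omega (u (e i) \- v)%R <= eps%:E)%E.
  move=> eps0; have [m Hm] := Hv _ (powR_gt0 r eps0); exists m => i mi.
  by rewrite Lp_norm_le ?(ltW eps0)//; exact: Hm.
exists e, v; split => //.
- split; first exact: measurable_funTS.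
  (* The limit is in L^r as the difference of [u (e m)] and [u (e m) - v]. *)
  have [m Hm] := Hv 1 ltr01.
  have [_ uoo] := cemb.1 _ (Xu (e m)).
  have ufin : Lp_norm r Omega (u (e m)) \is a fin_num by rewrite ge0_fin_numE.
  pose L := fine (Lp_norm r Omega (u (e m))).
  have L0 : 0 <= L by rewrite fine_ge0.
  have uL : (Lp_norm r Omega (u (e m)) <= L%:E)%E by rewrite fineK.
  rewrite Lp_norm_le// in uL.
  have muv : measurable_fun setT (fun x => u (e m) x - v x) by exact: measurable_funB.
  have := integral_powR_sub mOmega (ltW r0) (mu_ (e m)) muv uL (Hm m (leqnn m)).
  under eq_integral do rewrite subKr.
  rewrite -EFinD -EFinM; set c := _ * _ => vc.
  have c0 : 0 <= c by rewrite mulr_ge0 ?addr_ge0 ?powR_ge0.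
  apply: (@le_lt_trans _ _ (c `^ r^-1)%:E); last exact: ltry.
  rewrite Lp_norm_le ?powR_ge0//.
  by rewrite -powRrM mulVf ?gt_eqF// powRr1.
apply/fine_cvgP; split.
  have [m Hm] := Hnorm 1 ltr01; exists m => // i /= mi.
  by rewrite ge0_fin_numE// (le_lt_trans (Hm i mi))// ltry.
apply/cvgrPdist_lt => eps eps0.
(* Half of [eps], because [Hnorm] gives a weak inequality and a strict one is wanted. *)
have [m Hm] := Hnorm (eps / 2) (divr_gt0 eps0 (ltr0Sn R 1)); exists m => // i /= mi.
have fin : Lp_norm r Omega (u (e i) \- v) \is a fin_num.
  by rewrite ge0_fin_numE// (le_lt_trans (Hm i mi))// ltry.
rewrite sub0r normrN ger0_norm ?fine_ge0//.
have := Hm i mi; rewrite -{1}(fineK fin) lee_fin; lra.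
Qed.

End X0_embeddings.

Theorem theorem1p2 (R : realType) (k : nat) (n : 'I_k -> nat)
  (G : stratified_group R n) (N : 'rV[R]_(\sum_i n i) -> R)
  (hN : homogeneous_norm G N)
  (Omega : set 'rV[R]_(\sum_i n i)) (oOmega : open Omega)
  (s p : R) (s_gt0 : 0 < s) (s_lt1 : s < 1) (p_ge1 : 1 <= p)
  (Q_eq : (homogeneous_dim n)%:R = p * s) :
  (forall r : R, p <= r ->
    continuously_embedded (X0_space G N s p Omega) (X0_norm G N s p Omega)
      (Lp_space r Omega) (Lp_norm r Omega)) /\
  (bounded_set Omega -> connected Omega ->
    forall r : R, 1 <= r ->
      compactly_embedded (X0_space G N s p Omega) (X0_norm G N s p Omega)
        (Lp_space r Omega) (Lp_norm r Omega)).
Proof.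
split=> [r pr|bO _ r r1]; first exact: X0_continuously_embedded_ge.
exact: X0_compactly_embedded.
Qed.
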